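(* Let $n\ge 1$, let $\eta$ be a partition of $n$, and let $A$ be an $n\times n$ complex matrix. Then $$\operatorname{trace}\bigl(E_A^n\big|_{M_\eta(0)}\bigr)=\frac{s_\eta(A)}{s_\eta(I)}\,\chi_\eta(e).$$
   Context: Let $v_1,\dots,v_n$ be the standard orthonormal basis of $\mathbb{C}^n$. An $n\times n$ matrix $B$ acts diagonally on $(\mathbb{C}^n)^{\otimes n}$ by $B^{\otimes n}(v_{i_1}\otimes\cdots\otimes v_{i_n})=Bv_{i_1}\otimes\cdots\otimes Bv_{i_n}$. Let $du$ be the normalized Haar measure on the unitary group $U_n$ and write $A^u=uAu^{*}$. Define $E_A^n=\int_{U_n}(A^u)^{\otimes n}\,du$, an operator on $(\mathbb{C}^n)^{\otimes n}$. For a partition $\eta$ of $n$, $\chi_\eta$ is the irreducible character of $S_n$ indexed by $\eta$ (with $\chi_{(n)}$ trivial), $e$ is the identity of $S_n$, and $M_\eta\subseteq(\mathbb{C}^n)^{\otimes n}$ is an irreducible $U_n$-submodule (equivalently $GL_n(\mathbb{C})$-submodule) of the type indexed by $\eta$ (highest weight $\eta$). The zero weight space of $(\mathbb{C}^n)^{\otimes n}$ is the span of the tensors $v_{\sigma(1)}\otimes\cdots\otimes v_{\sigma(n)}$, $\sigma\in S_n$, and $M_\eta(0)$ is the intersection of $M_\eta$ with it. The operator $E_A^n$ maps $M_\eta(0)$ into itself, so the trace is defined. $s_\eta(A)$ denotes the Schur polynomial $s_\eta(x_1,\dots,x_n)$ evaluated at the eigenvalues of $A$ (with multiplicity), and $I$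 is the $n\times n$ identity matrix, so $s_\eta(I)=s_\eta(1,\dots,1)$. *)

(* Defs.v *)
From HB Require Import structures.
From mathcomp Require Import all_boot all_order all_algebra.
From mathcomp Require Import all_fingroup all_character.
From mathcomp Require Import complex.
From mathcomp Require Import all_classical all_reals all_analysis.

Set Implicit Arguments.
Unset Strict Implicit.
Unset Printing Implicit Defensive.

Import Order.TTheory GRing.Theory Num.Theory.
Import numFieldNormedType.Exports.

Local Open Scope classical_set_scope.
Local Open Scope ring_scope.
Local Open Scope sesquilinear_scope.

(* Partitions are nonincreasing sequences of positive integers. *)
Definition is_partition (eta : seq nat) (n : nat) : bool :=
  [&& sorted geq eta, 0%N \notin eta & sumn eta == n].

(* The boxes of the Young diagram of eta (English notation) are numbered
   0, 1, 2, ... row by row, from left to right. *)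
Definition box_row (eta : seq nat) (b : nat) : nat := reshape_index eta b.
Definition box_col (eta : seq nat) (b : nat) : nat := reshape_offset eta b.

Definition semistandard (eta : seq nat) (m : nat)
    (t : {ffun 'I_(sumn eta) -> 'I_m}) : bool :=
  [forall b : 'I_(sumn eta), forall c : 'I_(sumn eta),
    ((box_row eta b == box_row eta c) && (box_col eta b < box_col eta c)%N
       ==> (t b <= t c)%N)
    && ((box_col eta b == box_col eta c) && (box_row eta b < box_row eta c)%N
       ==> (t b < t c)%N)].

Definition schur (F : fieldType) (eta : seq nat) (m : nat) (x : 'I_m -> F) : F :=
  \sum_(t : {ffun 'I_(sumn eta) -> 'I_m} | semistandard t) \prod_b x (t b).

Definition eigenvalues (C : closedFieldType) (n : nat) (A : 'M[C]_n) : seq C :=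
  sval (closed_field_poly_normal (char_poly A)).

Definition schur_mx (C : closedFieldType) (eta : seq nat) (n : nat)
    (A : 'M[C]_n) : C :=
  schur eta (fun i : 'I_n => (eigenvalues A)`_i).

Section SpechtModule.
Variables (F : fieldType) (n : nat) (eta : seq nat).

Definition row_stab : {set 'S_n} :=
  [set s : 'S_n | [forall i, box_row eta (s i) == box_row eta i]].
Definition col_stab : {set 'S_n} :=
  [set s : 'S_n | [forall i, box_col eta (s i) == box_col eta i]].

Definition regular_rep := regular_repr F [set: 'S_n]%G.

(* The Young symmetrizer: the sum of sgn(q) p o q, for p preserving the rows
   and q preserving the columns.  In 'S_n the product (q * p)%g maps i to
   p (q i), so (q * p)%g is p o q. *)
Definition young_symmetrizer : 'rV[F]_#|[set: 'S_n]%G| :=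
  \sum_(p in row_stab) \sum_(q in col_stab)
     (-1) ^+ q *: delta_mx 0 (gring_index [set: 'S_n]%G (q * p)%g).

(* The ideal F[S_n] c generated by the Young symmetrizer c.  It is a left
   ideal for composition of permutations, which regular_mx writes on the
   right. *)
Definition specht_module : 'M[F]_#|[set: 'S_n]%G| :=
  cyclic_mx regular_rep young_symmetrizer.

Definition specht_repr :=
  submod_repr (cyclic_mx_module regular_rep young_symmetrizer).

Definition sym_char (s : 'S_n) : F := \tr (specht_repr s).

End SpechtModule.

(* An element x of (C^n)^{(x) n} is given by its coordinates: x i is the
   coefficient of v_(i 0) (x) ... (x) v_(i (n-1)). *)
Definition multi_index (n : nat) := {ffun 'I_n -> 'I_n}.
Definition tensor (F : fieldType) (n : nat) := {ffun multi_index n -> F^o}.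

Section Tensor.
Variables (F : fieldType) (n : nat).
Local Notation T := (tensor F n).

Definition tensor_basis (i : multi_index n) : T := [ffun j => (j == i)%:R].

(* The operator with matrix K in the basis (tensor_basis i)_i. *)
Definition kernel_fun (K : multi_index n -> multi_index n -> F) (x : T) : T :=
  [ffun j => \sum_i K j i * x i].

Fact kernel_fun_is_linear K : linear (kernel_fun K).
Proof.
move=> a x y; apply/ffunP => j; rewrite !ffunE scaler_sumr -big_split /=.
by apply: eq_bigr => i _; rewrite !ffunE mulrDr [in LHS]mulrCA.
Qed.

HB.instance Definition _ K :=
  GRing.isLinear.Build F T T _ (kernel_fun K) (kernel_fun_is_linear K).

Definition kernel_op K : 'End(T) := linfun (kernel_fun K).

Definition tpow_coef (B : 'M[F]_n) (j i : multi_index n) : F :=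
  \prod_k B (j k) (i k).

Definition tpow (B : 'M[F]_n) : 'End(T) := kernel_op (tpow_coef B).

Definition zero_weight_space : {vspace T} :=
  <<[seq tensor_basis (finfun s) | s : 'S_n]>>%VS.

End Tensor.

(* The trace of f restricted to U, for f mapping U to itself. *)
Definition trace_on (F : fieldType) (V : vectType F) (U : {vspace V})
    (f : 'End(V)) : F :=
  \sum_(i < \dim U) coord (vbasis U) i (f (vbasis U)`_i).

Definition unitary_group (R : realType) (n : nat) :=
  {u : 'M[R[i]]_n | u \is unitarymx}.

Section UnitaryGroup.
Variables (R : realType) (n : nat).
Local Notation U := (unitary_group R n).

HB.instance Definition _ := Choice.on U.

Fact unitary1_subproof : (1%:M : 'M[R[i]]_n) \is unitarymx.
Proof. by apply/unitarymxP; rewrite trmx1 map_mx1 mul1mx. Qed.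

HB.instance Definition _ := isPointed.Build U (exist _ 1%:M unitary1_subproof).

Definition unitary_mul (g u : U) : U :=
  exist _ (val g *m val u) (mul_unitarymx (valP g) (valP u)).

(* The open sets of the subspace topology. *)
Definition unitary_open : set (set U) :=
  [set val @^-1` O | O in [set O : set 'M[(R[i])^o]_n | open O]].

Definition unitary_borel := g_sigma_algebraType unitary_open.

(* On a compact group, left-invariance and total mass 1 characterize the
   normalized Haar measure. *)
Definition is_haar (mu : probability unitary_borel R) : Prop :=
  forall (g : U) (B : set unitary_borel), measurable B ->
    mu (unitary_mul g @^-1` B) = mu B.

Definition cintegral (mu : probability unitary_borel R) (f : U -> R[i]) : R[i] :=
  ((\int[mu]_u complex.Re (f u))%R +i* (\int[mu]_u complex.Im (f u))%R)%C.

Definition conj_by (A : 'M[R[i]]_n) (u : U) : 'M[R[i]]_n :=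
  val u *m A *m (val u)^t*.

(* The integral of the operator-valued function u |-> (A^u)^{(x) n} is taken
   entrywise in the basis tensor_basis. *)
Definition averaged_op (mu : probability unitary_borel R) (A : 'M[R[i]]_n) :
    'End(tensor R[i] n) :=
  kernel_op (fun j i => cintegral mu (fun u => tpow_coef (conj_by A u) j i)).

Definition unitary_submodule (M : {vspace tensor R[i] n}) : Prop :=
  forall u : U, (tpow (val u) @: M <= M)%VS.

Definition irreducible_submodule (M : {vspace tensor R[i] n}) : Prop :=
  [/\ unitary_submodule M, M != 0%VS &
    forall N : {vspace tensor R[i] n},
      unitary_submodule N -> (N <= M)%VS -> N = 0%VS \/ N = M].

(* M contains a highest weight vector of weight eta: a nonzero vector on which
   the upper triangular Borel subgroup of GL_n acts through
   b |-> \prod_i b_ii ^ eta_i. *)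
Definition has_highest_weight (M : {vspace tensor R[i] n}) (eta : seq nat) :
    Prop :=
  exists w, [/\ w \in M, w != 0 &
    forall b : 'M[R[i]]_n, b \in unitmx ->
      (forall i j : 'I_n, (j < i)%N -> b i j = 0) ->
      tpow b w = (\prod_i b i i ^+ nth 0%N eta i) *: w].

End UnitaryGroup.

(* Main.v *)
From HB Require Import structures.
Require Import Defs.
From mathcomp Require Import all_boot all_order all_algebra.
From mathcomp Require Import all_fingroup all_character.
From mathcomp Require Import complex.
From mathcomp Require Import all_classical all_reals all_analysis.
From mathcomp Require Import measurable_realfun zify ring.

(** By invariance of the Haar measure, [E_A] commutes with the unitary group;
    it also preserves [M], so by Schur's lemma it is a scalar [z] on [M], with
    [z dim M = tr (E_A | M) = tr (A^n | M)], where [A^n] is the tensor power.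
    Hence the trace on [M(0)] is [z dim M(0)], and it remains to show that
    [tr (A^n | M) = s_eta(A)] and that [M(0)] has the dimension of the Specht
    module.

    Let [a] and [b] be the row symmetrizer and the column antisymmetrizer,
    acting by permuting tensor factors, and let [e] be the basis tensor whose
    [k]-th index is the row of the box [k].  A highest weight vector [w] of
    weight [eta] has the form [gamma e] with [gamma] in the group algebra of
    [S_n], and polarization identifies [M] with the image of [gamma a].  The
    function [g |-> <g w, w>] is determined up to a scalar by the weight,
    because it is so on the dense set of products of a lower and an upper
    triangular matrix.  Comparing with the highest weight vector [b e] shows
    that [gamma a] and [b a] have the same kernel, so that [M] is isomorphic
    to the image of [b a], and also to the image of [a b] since [b a] is the
    adjoint of [a b].  The zero weight part of the image of [b a] is the Specht
    module.  The image of [a b] has a basis of weight vectors indexed by the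
    semistandard tableaux, by the Garnir relations, which gives the trace of a
    diagonal matrix; a general matrix is triangularized and degenerated to its
    diagonal part. *)

Set Implicit Arguments.
Unset Strict Implicit.
Unset Printing Implicit Defensive.

Import Order.TTheory GRing.Theory Num.Theory.

Local Open Scope ring_scope.
Local Open Scope sesquilinear_scope.

(** * Traces on subspaces *)

Section TraceOn.
Variables (F : fieldType) (V : vectType F).
Implicit Types (U W : {vspace V}) (f g L : 'End(V)).

(** [trace_on] is computed in the chosen basis [vbasis U]. The transition matrices [P] and [Q] to
    another basis are mutually inverse, and cyclicity of the matrix trace removes them. *)
Lemma trace_on_basis U m (X : m.-tuple V) f :
  basis_of U X -> {in U, forall x, f x \in U} ->
  trace_on U f = \sum_(i < m) coord X i (f X`_i).
Proof.
move=> bX fU; have bY := vbasisP U; rewrite /trace_on.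
set Y := vbasis U in bY *.
have XU (i : 'I_m) : X`_i \in U by apply: (basis_mem bX); rewrite mem_nth ?size_tuple.
have YU (i : 'I_(\dim U)) : Y`_i \in U by apply: (basis_mem bY); rewrite mem_nth ?size_tuple.
pose P := \matrix_(i < m, j < \dim U) coord Y j X`_i.
pose Q := \matrix_(j < \dim U, i < m) coord X i Y`_j.
pose G := \matrix_(i < m, k < m) coord X k (f X`_i).
have QP : Q *m P = 1%:M.
  apply/matrixP => i j; rewrite !mxE -(coord_free _ _ (basis_free bY)).
  rewrite [in RHS](coord_basis bX (YU i)) linear_sum; apply: eq_bigr => k _.
  by rewrite !mxE linearZ.
have -> : \sum_(i < \dim U) coord Y i (f Y`_i) = \tr (Q *m (G *m P)).
  apply: eq_bigr => j _; rewrite mxE.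
  have -> : f Y`_j = \sum_i coord X i Y`_j *: f X`_i.
    rewrite {1}(coord_basis bX (YU j)) linear_sum.
    by apply: eq_bigr => i _; rewrite linearZ.
  rewrite linear_sum; apply: eq_bigr => i _.
  rewrite !mxE linearZ /=; congr (_ * _).
  rewrite [in LHS](coord_basis bX (fU _ (XU i))) linear_sum.
  by apply: eq_bigr => k _; rewrite !mxE linearZ.
rewrite mulmxA mxtrace_mulC mulmxA.
have PQ : P *m Q = 1%:M.
  apply/matrixP => i j; rewrite !mxE -(coord_free _ _ (basis_free bX)).
  rewrite [in RHS](coord_basis bY (XU i)) linear_sum; apply: eq_bigr => k _.
  by rewrite !mxE linearZ.
by rewrite PQ mul1mx; apply: eq_bigr => i _; rewrite mxE.
Qed.

Lemma trace_on_diag U m (X : m.-tuple V) f (a : 'I_m -> F) :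
  basis_of U X -> (forall i : 'I_m, f X`_i = a i *: X`_i) ->
  trace_on U f = \sum_i a i.
Proof.
move=> bX fX; rewrite (trace_on_basis bX) => [|x xU].
  apply: eq_bigr => i _; rewrite fX linearZ /= (coord_free _ _ (basis_free bX)).
  by rewrite eqxx mulr1.
rewrite (coord_basis bX xU) linear_sum; apply: memv_suml => i _.
rewrite linearZ; apply: memvZ; rewrite [X in X \in _]fX; apply: memvZ.
by apply: (basis_mem bX); rewrite mem_nth ?size_tuple.
Qed.

Lemma trace_on_scalar U f c :
  {in U, forall x, f x = c *: x} -> trace_on U f = c * (\dim U)%:R.
Proof.
move=> fc; rewrite (@trace_on_diag _ _ (vbasis U) f (fun=> c)) ?vbasisP //.
  by rewrite sumr_const card_ord mulr_natr.
by move=> i; rewrite fc // vbasis_mem // mem_nth ?size_tuple.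
Qed.

Lemma trace_on_iso U W f f' (phi : 'End(V)) :
  (U :&: lker phi)%VS = 0%VS -> (phi @: U)%VS = W ->
  {in U, forall x, f x \in U} -> {in U, forall x, phi (f x) = f' (phi x)} ->
  trace_on U f = trace_on W f'.
Proof.
move=> injU imU fU comm; have bX := vbasisP U.
set X := vbasis U in bX *.
have bY : basis_of W (map_tuple phi X) by rewrite -imU limg_basis_of.
have XU (i : 'I_(\dim U)) : X`_i \in U by apply: (basis_mem bX); rewrite mem_nth ?size_tuple.
rewrite (trace_on_basis bX) // (trace_on_basis bY) => [|y].
  apply: eq_bigr => i _; rewrite (nth_map 0) ?size_tuple // -comm //.
  rewrite [in RHS](coord_basis bX (fU _ (XU i))) !linear_sum /=.
  rewrite (bigD1 i) //= big1 ?addr0 => [|j ji].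
    rewrite !linearZ /= -(@nth_map _ 0 _ 0 phi) ?size_tuple //.
    by rewrite (coord_free _ _ (basis_free bY)) eqxx mulr1.
  rewrite !linearZ /= -(@nth_map _ 0 _ 0 phi) ?size_tuple //.
  by rewrite (coord_free _ _ (basis_free bY)) (negPf ji) mulr0.
rewrite -imU => /memv_imgP[x xU ->]; rewrite -comm // memv_img // fU //.
Qed.

(** Both images are the quotient of the space by the common kernel: [phi] sends [L x] to [L' x],
    since [x] and the preimage of [L x] chosen by [L^-1] differ by an element of that kernel. *)
Lemma trace_on_limg L L' f :
  lker L = lker L' -> (forall x, f (L x) = L (f x)) ->
  (forall x, f (L' x) = L' (f x)) ->
  trace_on (limg L) f = trace_on (limg L') f.
Proof.
move=> eqk fL fL'; pose phi := (L' \o L^-1)%VF.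
have phiL x : phi (L x) = L' x.
  rewrite comp_lfunE; apply/eqP; rewrite -subr_eq0 -linearB /=.
  by rewrite -memv_ker -eqk memv_ker linearB /= limg_lfunVK ?subrr // memv_img ?memvf.
apply: (@trace_on_iso _ _ _ _ phi).
- apply/eqP; rewrite -subv0; apply/subvP => y; rewrite memv_cap => /andP[].
  case/memv_imgP => x _ ->; rewrite memv_ker phiL -memv_ker -eqk memv_ker.
  by move/eqP->; rewrite mem0v.
- apply/eqP; rewrite eqEsubv; apply/andP; split; apply/subvP => y.
    case/memv_imgP => z /memv_imgP[x _ ->] ->; rewrite phiL memv_img ?memvf //.
  by case/memv_imgP => x _ ->; rewrite -phiL memv_img // memv_img ?memvf.
- by move=> y /memv_imgP[x _ ->]; rewrite fL memv_img ?memvf.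
- by move=> y /memv_imgP[x _ ->]; rewrite fL !phiL fL'.
Qed.

End TraceOn.

(** * Operators on the tensor space *)

(** Precomposition with [s]. Since [(s' * s)%g] applies [s'] first, the factors appear reversed in
    [permuteM]. *)
Definition permute (n : nat) (t : multi_index n) (s : 'S_n) : multi_index n :=
  [ffun b => t (s b)].

Lemma permuteM n (t : multi_index n) s s' :
  permute (permute t s) s' = permute t (s' * s)%g.
Proof. by apply/ffunP => b; rewrite !ffunE permM. Qed.

Lemma permute1 n (t : multi_index n) : permute t 1%g = t.
Proof. by apply/ffunP => b; rewrite ffunE perm1. Qed.

Lemma permuteK n (s : 'S_n) : cancel (fun t => permute t s) (fun t => permute t s^-1%g).
Proof. by move=> t; rewrite permuteM mulVg permute1. Qed.

Lemma permuteVK n (s : 'S_n) : cancel (fun t => permute t s^-1%g) (fun t => permute t s).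
Proof. by move=> t; rewrite permuteM mulgV permute1. Qed.

Section TensorOps.
Variables (F : fieldType) (n : nat).
Local Notation T := (tensor F n).
Implicit Types (x y : T) (A B : 'M[F]_n) (i j t : multi_index n) (s : 'S_n).

Lemma kernel_opE K x j : (kernel_op K x) j = \sum_i K j i * x i.
Proof. by rewrite lfunE ffunE. Qed.

Lemma tpowE A x j : (tpow A x) j = \sum_(i : multi_index n) (\prod_k A (j k) (i k)) * x i.
Proof. exact: kernel_opE. Qed.

Lemma tensor_sum x : x = \sum_i x i *: tensor_basis F i.
Proof.
apply/ffunP => j; rewrite sum_ffunE (bigD1 j) //= !ffunE eqxx big1 => [|i ij].
  by rewrite addr0 [RHS]mulr1.
by rewrite !ffunE eq_sym (negPf ij) [LHS]mulr0.
Qed.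

Lemma tpowM A B x : tpow (A *m B) x = tpow A (tpow B x).
Proof.
apply/ffunP => j; rewrite !tpowE.
under [RHS]eq_bigr do rewrite tpowE mulr_sumr.
rewrite exchange_big /=; apply: eq_bigr => i _.
under [RHS]eq_bigr do rewrite mulrA -big_split /=.
rewrite -mulr_suml; congr (_ * _).
rewrite -(bigA_distr_bigA (fun k l => A (j k) l * B l (i k))) /=.
by apply: eq_bigr => k _; rewrite mxE.
Qed.

Lemma tpowZ c A x : tpow (c *: A) x = c ^+ n *: tpow A x.
Proof.
apply/ffunP => j; rewrite ffunE !tpowE [RHS]mulr_sumr; apply: eq_bigr => i _.
under eq_bigr do rewrite mxE.
by rewrite big_split /= prodr_const card_ord mulrA.
Qed.

Lemma tpow_diag (d : 'rV[F]_n) x j :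
  (tpow (diag_mx d) x) j = (\prod_k d 0 (j k)) * x j.
Proof.
rewrite tpowE (bigD1 j) //= [X in _ + X]big1 => [|i ij].
  by rewrite addr0; congr (_ * _); apply: eq_bigr => k _; rewrite mxE eqxx.
have [k jk] : exists k, j k != i k.
  by apply/existsP; apply: contraNT ij; rewrite negb_exists => /forallP H;
     apply/eqP/ffunP => k; apply/eqP; have := H k; rewrite negbK eq_sym.
by rewrite (bigD1 k) //= mxE (negPf jk) mulr0n !mul0r.
Qed.

Lemma tpow1 x : tpow 1%:M x = x.
Proof.
apply/ffunP => j; rewrite -diag_const_mx tpow_diag big1 ?mul1r // => k _.
by rewrite mxE.
Qed.

(** Coordinates are pulled back, so [s] sends the basis tensor of [t] to that of
    [permute t s^-1]. *)
Definition group_op (c : 'S_n -> F) : 'End(T) :=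
  kernel_op (fun j i => \sum_s c s * (permute j s == i)%:R).

Lemma group_opE c x j : (group_op c x) j = \sum_s c s * x (permute j s).
Proof.
rewrite kernel_opE; under eq_bigr do rewrite mulr_suml.
rewrite exchange_big /=; apply: eq_bigr => s _.
rewrite (bigD1 (permute j s)) //= eqxx mulr1 big1 ?addr0 // => i ij.
by rewrite eq_sym (negPf ij) mulr0 mul0r.
Qed.

(** The easy half of Schur-Weyl duality: permuting both indices of an entry of the tensor power only
    reorders the product defining it. *)
Lemma group_op_tpow c A x : group_op c (tpow A x) = tpow A (group_op c x).
Proof.
apply/ffunP => j; rewrite group_opE tpowE.
under [RHS]eq_bigr do rewrite group_opE mulr_sumr.
rewrite exchange_big /=; apply: eq_bigr => s _; rewrite tpowE mulr_sumr.
rewrite (reindex_inj (can_inj (@permuteK n s))) /=; apply: eq_bigr => i _.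
rewrite mulrCA; congr (_ * _); rewrite [RHS](reindex_inj (@perm_inj _ s)) /=.
by apply: eq_bigr => k _; rewrite !ffunE.
Qed.

Definition pairing (c : multi_index n -> F) x : F := \sum_j c j * x j.

Lemma pairing_sum c (I : Type) (r : seq I) (P : pred I) (f : I -> T) (a : I -> F) :
  pairing c (\sum_(i <- r | P i) a i *: f i) =
  \sum_(i <- r | P i) a i * pairing c (f i).
Proof.
rewrite /pairing; under eq_bigr do rewrite sum_ffunE mulr_sumr.
rewrite exchange_big; apply: eq_bigr => i _; rewrite mulr_sumr.
by apply: eq_bigr => j _; rewrite ffunE [RHS]mulrCA.
Qed.

Lemma lfun_pairing (f : 'End(T)) x j :
  (f x) j = pairing (fun l => (f (tensor_basis F l)) j) x.
Proof.
rewrite {1}[x]tensor_sum linear_sum sum_ffunE; apply: eq_bigr => l _.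
by rewrite linearZ ffunE [LHS]mulrC.
Qed.

(** A subspace is cut out by the linear functionals vanishing on it; the ones used are the
    coordinates of [x - projv U x]. *)
Lemma mem_pairing (U : {vspace T}) x :
  (forall c, {in U, forall u, pairing c u = 0} -> pairing c x = 0) -> x \in U.
Proof.
move=> H; suff E : x = projv U x by rewrite E memv_proj.
apply/ffunP => j; apply/eqP; rewrite -subr_eq0; apply/eqP.
have projE y : y j - (projv U y) j = pairing (fun l => (tensor_basis F l) j -
     (projv U (tensor_basis F l)) j) y.
  rewrite [X in _ - X]lfun_pairing /pairing.
  under [RHS]eq_bigr do rewrite mulrBl; rewrite big_split sumrN /=; congr (_ - _).
  rewrite {1}[y]tensor_sum sum_ffunE; apply: eq_bigr => l _.
  by rewrite ffunE [LHS]mulrC.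
rewrite [LHS]projE; apply: H => u uU.
by rewrite -projE projv_id // subrr.
Qed.

End TensorOps.

(** * Zariski density along polynomial curves of matrices *)

Section PolynomialDensity.
Variables (F : numFieldType).

(** The product [p * q] vanishes at all natural numbers, which are pairwise distinct in [F], so it
    has too many roots to be nonzero. *)
Lemma poly_nat_eq0 (p q : {poly F}) : q != 0 ->
  (forall k : nat, q.[k%:R] != 0 -> p.[k%:R] = 0) -> p = 0.
Proof.
move=> q0 H; suff /eqP : p * q = 0 by rewrite mulf_eq0 (negPf q0) orbF => /eqP.
apply/eqP; apply: contraT => r0; set r := p * q in r0.
have := @max_poly_roots _ r [seq k%:R | k <- iota 0 (size r)] r0.
rewrite size_map size_iota ltnn => -> //.
  apply/allP => _ /mapP[k _ ->]; rewrite rootE hornerM.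
  by have [->|/H->] := eqVneq q.[k%:R] 0; rewrite ?mulr0 ?mul0r.
by rewrite map_inj_uniq ?iota_uniq // => a b /eqP; rewrite eqr_nat => /eqP.
Qed.

Variable n : nat.
Local Notation T := (tensor F n).
Local Notation "P @ t" := (map_mx (horner_eval t) P).

Lemma tpow_poly (c : multi_index n -> F) (x : T) (P : 'M[{poly F}]_n) :
  exists p : {poly F}, forall t, p.[t] = pairing c (tpow (P @ t) x).
Proof.
exists (\sum_(j : multi_index n) c j *: \sum_(i : multi_index n) x i *: \prod_k P (j k) (i k)) => t.
rewrite horner_sum; apply: eq_bigr => j _; rewrite hornerZ tpowE horner_sum.
congr (_ * _); apply: eq_bigr => i _; rewrite hornerZ mulrC horner_prod.
by congr (_ * _); apply: eq_bigr => k _; rewrite mxE.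
Qed.

Lemma tpow_dense_pairing c (x : T) (P : 'M[{poly F}]_n) (q : {poly F}) : q != 0 ->
  (forall k : nat, q.[k%:R] != 0 -> pairing c (tpow (P @ k%:R) x) = 0) ->
  forall t, pairing c (tpow (P @ t) x) = 0.
Proof.
move=> q0 H t; have [p pE] := tpow_poly c x P.
by rewrite -pE (@poly_nat_eq0 p q) ?horner0 // => k qk; rewrite pE H.
Qed.

(** Membership in [U] is a system of polynomial equations in the parameter. In the applications [q]
    is 1 or a determinant, whose roots are the excluded parameters. *)
Lemma tpow_dense_mem (U : {vspace T}) (x : T) (P : 'M[{poly F}]_n) (q : {poly F}) :
  q != 0 -> (forall k : nat, q.[k%:R] != 0 -> tpow (P @ k%:R) x \in U) ->
  forall t, tpow (P @ t) x \in U.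
Proof.
move=> q0 H t; apply: mem_pairing => c cU.
by apply: (tpow_dense_pairing q0) => k /H/cU.
Qed.

End PolynomialDensity.

(** * Young diagrams *)

Section Boxes.
Variable eta : seq nat.
Hypothesis eta_sorted : sorted geq eta.
Hypothesis eta_pos : 0%N \notin eta.
Local Notation n := (sumn eta).
Local Notation row := (box_row eta).
Local Notation col := (box_col eta).

Lemma box_inj (b c : 'I_n) : row b = row c -> col b = col c -> b = c.
Proof.
by move=> rE cE; apply/val_inj; rewrite /= -(reshape_indexK eta b) -(reshape_indexK eta c)
  -[reshape_index eta b]/(row b) rE -[reshape_offset eta b]/(col b) cE.
Qed.

(** Row lengths decrease, so the diagram is closed under moving up and to the left. *)
Lemma box_ex (b : 'I_n) r c : (r <= row b)%N -> (c <= col b)%N ->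
  exists2 d : 'I_n, row d = r & col d = c.
Proof.
move=> rb cb; have bn := ltn_ord b.
have rs : (row b < size eta)%N by apply: reshape_indexP.
have cs : (col b < nth 0 eta (row b))%N by apply: reshape_offsetP.
have leq_nth : (nth 0 eta (row b) <= nth 0 eta r)%N.
  apply: (sorted_leq_nth (leT := geq)) => //.
  - by move=> x y z /= yx zy; apply: leq_trans zy yx.
  - by move=> x /=.
  - by rewrite inE (leq_ltn_trans rb).
have cr : (c < nth 0 eta r)%N by apply: leq_ltn_trans cb (leq_trans cs leq_nth).
have fl : (flatten_index eta r c < n)%N by apply: flatten_indexP => //; apply: leq_ltn_trans rb rs.
by exists (Ordinal fl); [apply: flatten_indexKl | apply: flatten_indexKr].
Qed.

Lemma size_partition : (size eta <= n)%N.
Proof.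
elim: eta eta_pos => //= x s IH; rewrite in_cons negb_or => /andP[x0 /IH].
by case: x x0 => // x _ le; rewrite addSn ltnS (leq_trans le) ?leq_addl.
Qed.

Lemma box_row_lt (b : 'I_n) : (row b < n)%N.
Proof. by apply: leq_trans size_partition; apply: reshape_indexP. Qed.

End Boxes.

(** * Polytabloids and Garnir relations *)

Section Polytabloids.
Variables (F : numFieldType) (eta : seq nat).
Hypothesis eta_sorted : sorted geq eta.
Hypothesis eta_pos : 0%N \notin eta.
Local Notation n := (sumn eta).
Local Notation row := (box_row eta).
Local Notation col := (box_col eta).
Local Notation R := (row_stab n eta).
Local Notation C := (col_stab n eta).
Local Notation T := (tensor F n).
Implicit Types (t j : multi_index n) (s p q : 'S_n) (b c : 'I_n).

Lemma row_stabP s : reflect (forall b, row (s b) = row b) (s \in R).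
Proof. by rewrite inE; apply: (iffP forallP) => H b; apply/eqP. Qed.

Lemma col_stabP s : reflect (forall b, col (s b) = col b) (s \in C).
Proof. by rewrite inE; apply: (iffP forallP) => H b; apply/eqP. Qed.

Lemma row_stab1 : (1 : 'S_n)%g \in R.
Proof. by apply/row_stabP => b; rewrite perm1. Qed.

Lemma col_stab1 : (1 : 'S_n)%g \in C.
Proof. by apply/col_stabP => b; rewrite perm1. Qed.

Lemma row_stabMl s p : p \in R -> (p * s \in R)%g = (s \in R).
Proof.
move/row_stabP=> pR; apply/row_stabP/row_stabP => H b.
  by have := H (p^-1 b)%g; rewrite permM permKV => ->; rewrite -pR permKV.
by rewrite permM H pR.
Qed.

Lemma col_stabMl s p : p \in C -> (p * s \in C)%g = (s \in C).
Proof.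
move/col_stabP=> pR; apply/col_stabP/col_stabP => H b.
  by have := H (p^-1 b)%g; rewrite permM permKV => ->; rewrite -pR permKV.
by rewrite permM H pR.
Qed.

Lemma row_stabV p : (p^-1 \in R)%g = (p \in R).
Proof.
apply/row_stabP/row_stabP => H b; last by rewrite -H permKV.
by rewrite -{2}[b](permK p) H.
Qed.

Lemma col_stabV p : (p^-1 \in C)%g = (p \in C).
Proof.
apply/col_stabP/col_stabP => H b; last by rewrite -H permKV.
by rewrite -{2}[b](permK p) H.
Qed.

Lemma tperm_row_stab b c : row b = row c -> tperm b c \in R.
Proof. by move=> bc; apply/row_stabP => d; case: tpermP => // ->. Qed.

Lemma tperm_col_stab b c : col b = col c -> tperm b c \in C.
Proof. by move=> bc; apply/col_stabP => d; case: tpermP => // ->. Qed.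

Definition row_sym : 'End(T) := group_op (fun s => (s \in R)%:R).
Definition col_alt : 'End(T) := group_op (fun s => (s \in C)%:R * (-1) ^+ s).

Lemma row_symE (x : T) j : (row_sym x) j = \sum_(p in R) x (permute j p).
Proof.
rewrite group_opE [RHS]big_mkcond; apply: eq_bigr => s _.
by case: (s \in R); rewrite ?mul1r ?mul0r.
Qed.

Lemma col_altE (x : T) j :
  (col_alt x) j = \sum_(q in C) (-1) ^+ q * x (permute j q).
Proof.
rewrite group_opE [RHS]big_mkcond; apply: eq_bigr => s _.
by case: (s \in C); rewrite ?mul1r ?mul0r.
Qed.

Definition polytabloid t : T := row_sym (col_alt (tensor_basis F t)).

Lemma polytabloidE t j : polytabloid t j =
  \sum_(p in R) \sum_(q in C) (-1) ^+ q * (permute (permute j p) q == t)%:R.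
Proof.
rewrite row_symE; apply: eq_bigr => p _; rewrite col_altE.
by apply: eq_bigr => q _; rewrite ffunE.
Qed.

Lemma col_alt_basis_permute t q : q \in C ->
  col_alt (tensor_basis F (permute t q)) = (-1) ^+ q *: col_alt (tensor_basis F t).
Proof.
move=> qC; apply/ffunP => j; rewrite [RHS]ffunE !col_altE [RHS]mulr_sumr.
rewrite (reindex_inj (mulgI q)) /=; apply: eq_big => [s|s _].
  by rewrite col_stabMl.
rewrite odd_permM signr_addb -mulrA -permuteM !ffunE; congr (_ * (_ * _%:R)).
by rewrite (inj_eq (can_inj (@permuteK _ q))).
Qed.

(** The transposition of [b] and [c] fixes the filling and reverses the sign of its alternation, and
    2 is invertible. *)
Lemma col_alt_basis_eq0 t b c : b != c -> col b = col c -> t b = t c ->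
  col_alt (tensor_basis F t) = 0.
Proof.
move=> bc cE tE; have tt : permute t (tperm b c) = t.
  by apply/ffunP => d; rewrite ffunE; case: tpermP => // ->.
have := col_alt_basis_permute t (tperm_col_stab cE).
rewrite tt odd_tperm bc expr1 scaleN1r.
move/eqP; rewrite -addr_eq0 => /eqP H; apply/ffunP => j; apply/eqP.
have /ffunP/(_ j) := H; rewrite ![in X in X -> _]ffunE ffunE => /eqP.
by rewrite -mulr2n -[_ *+ 2]mulr_natr mulf_eq0 pnatr_eq0 orbF.
Qed.

Lemma polytabloid_col t q : q \in C ->
  polytabloid (permute t q) = (-1) ^+ q *: polytabloid t.
Proof. by move=> qC; rewrite /polytabloid col_alt_basis_permute // linearZ. Qed.

Lemma polytabloid_eq0 t b c : b != c -> col b = col c -> t b = t c ->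
  polytabloid t = 0.
Proof. by move=> bc cE tE; rewrite /polytabloid (col_alt_basis_eq0 bc cE tE) linear0. Qed.

(* For each column permutation [q], exchanging the two boxes of [Z] that [q]
   sends to the same row pairs off terms of opposite signs. *)
Lemma garnir (Z : {set 'I_n}) t :
  (forall q, q \in C -> exists z1 z2,
     [/\ z1 \in Z, z2 \in Z, z1 != z2 & row (q z1) = row (q z2)]) ->
  \sum_(s | perm_on Z s) (-1) ^+ s *: polytabloid (permute t s) = 0.
Proof.
move=> ZP; apply/ffunP => j; rewrite sum_ffunE [RHS]ffunE.
under eq_bigr do rewrite ffunE polytabloidE [_ *: _]mulr_sumr.
under eq_bigr do under eq_bigr do rewrite mulr_sumr.
under eq_bigr do rewrite exchange_big /=.
rewrite exchange_big /=; apply: big1 => q qC.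
have [z1 [z2 [z1Z z2Z z12 rE]]] := ZP q qC.
set G := LHS.
have tR : tperm (q z1) (q z2) \in R by apply: tperm_row_stab.
have tZ : perm_on Z (tperm z1 z2).
  apply/fintype.subsetP => x; rewrite inE; case: tpermP => [->|->|]; rewrite ?eqxx //.
have : G = - G.
  rewrite {1}/G (reindex_inj (mulgI (tperm z1 z2))) /= /G -sumrN.
  apply: eq_big => [s|s sZ].
    apply/idP/idP => H; last by apply: perm_onM.
    by rewrite -[s](mulKg (tperm z1 z2)) perm_onM // perm_onV.
  (* The exchange is absorbed by the row permutation: conjugation by [q] turns [tperm z1 z2] into
     [tperm (q z1) (q z2)], which lies in [R]. *)
  rewrite -sumrN (reindex_inj (mulgI (tperm (q z1) (q z2)))) /=.
  apply: eq_big => [p|p pR]; first by rewrite row_stabMl.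
  rewrite odd_permM odd_tperm z12 signr_addb mulN1r mulNr; congr (- (_ * (_ * _%:R))).
  rewrite !permuteM -(inj_eq (can_inj (@permuteK _ (tperm z1 z2)))).
  rewrite !permuteM [X in permute t X]mulgA tperm2 mul1g; congr (permute j _ == _).
  by rewrite -tpermJ /conjg -!mulgA mulKVg [LHS]mulgA tperm2 mul1g.
move/eqP; rewrite -addr_eq0 -mulr2n -mulr_natr mulf_eq0 pnatr_eq0 orbF.
by move/eqP.
Qed.

End Polytabloids.

(** * Straightening into semistandard fillings *)

Section Straightening.
Variables (F : numFieldType) (eta : seq nat).
Hypothesis eta_sorted : sorted geq eta.
Hypothesis eta_pos : 0%N \notin eta.
Local Notation n := (sumn eta).
Local Notation row := (box_row eta).
Local Notation col := (box_col eta).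
Local Notation R := (row_stab n eta).
Local Notation C := (col_stab n eta).
Local Notation T := (tensor F n).
Local Notation polytabloid := (@polytabloid F eta).
Implicit Types (t j S : multi_index n) (s p q : 'S_n) (b c : 'I_n).

Definition column_strict t :=
  forall b c, col b = col c -> (row b < row c)%N -> (t b < t c)%N.

Definition row_weak t :=
  forall b c, row b = row c -> (col b < col c)%N -> (t b <= t c)%N.

Lemma semistandardP t :
  reflect (row_weak t /\ column_strict t) (semistandard t).
Proof.
apply: (iffP forallP) => [H|[H1 H2] b].
  by split=> b c E L; have /forallP/(_ c)/andP[] := H b; rewrite E L eqxx.
apply/forallP => c; apply/andP; split; apply/implyP => /andP[/eqP E L].
  exact: H1.
exact: H2.
Qed.

Definition box_row_ord (b : 'I_n) : 'I_n := Ordinal (box_row_lt eta_pos b).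

(** The set [Z] has one box more than the column of [b0]. Since [q] preserves columns and the column
    of [c0] is no longer than that of [b0], the images of [Z] only meet rows of the latter column,
    so two of them share a row. *)
Lemma garnir_pigeonhole b0 c0 (Z : {set 'I_n}) :
  row b0 = row c0 -> (col b0 < col c0)%N ->
  Z = [set b : 'I_n | (col b == col b0) && (row b0 <= row b)%N]
      :|: [set b : 'I_n | (col b == col c0) && (row b <= row b0)%N] ->
  forall q, q \in C -> exists z1 z2,
     [/\ z1 \in Z, z2 \in Z, z1 != z2 & row (q z1) = row (q z2)].
Proof.
pose X := [set b : 'I_n | (col b == col b0) && (row b0 <= row b)%N].
pose Y := [set b : 'I_n | (col b == col c0) && (row b <= row b0)%N].
rewrite -/X -/Y => rE cL ZE q /col_stabP qC.
have [|noZ] :=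
  boolP [exists z1, exists z2, [&& z1 \in Z, z2 \in Z, z1 != z2 & row (q z1) == row (q z2)]].
  by case/existsP => z1 /existsP[z2 /and4P[? ? ? /eqP ?]]; exists z1, z2.
exfalso.
have injZ : {in Z &, injective (fun z => box_row_ord (q z))}.
  move=> z1 z2 Z1 Z2 /(congr1 val) /= E; apply/eqP; apply: contraNT noZ => z12.
  by apply/existsP; exists z1; apply/existsP; exists z2; rewrite Z1 Z2 z12 E eqxx.
pose K := [set b : 'I_n | col b == col b0].
have injcol (A : {set 'I_n}) : A \subset K -> {in A &, injective box_row_ord}.
  move=> /fintype.subsetP AK b c /AK + /AK; rewrite !inE => /eqP bE /eqP cE.
  by move/(congr1 val) => /= E; apply: box_inj; rewrite ?bE ?cE.
have leZ : (#|Z| <= #|K|)%N.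
  rewrite -(card_in_imset injZ); apply: leq_trans (leq_imset_card box_row_ord K).
  apply: subset_leq_card; apply/fintype.subsetP => _ /imsetP[z zZ ->].
  have [d dr dc] : exists2 d : 'I_n, row d = row (q z) & col d = col b0.
    apply: box_ex => //; rewrite qC; move: zZ; rewrite ZE !inE.
    by case/orP => /andP[/eqP-> _] //; apply: ltnW.
  by apply/imsetP; exists d; [rewrite inE dc | apply: val_inj].
have XY : [disjoint X & Y].
  apply/pred0P => b /=; rewrite !inE; apply/negbTE/negP => /andP[/andP[/eqP-> _]].
  by case/andP => /eqP E _; rewrite E ltnn in cL.
have XK : X \subset K by apply/fintype.subsetP => b; rewrite !inE => /andP[].
(* The boxes above [b0] in its column match, row by row, boxes of [Y] other than [c0]. *)
have : (#|K :\: X| < #|Y|)%N.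
  have DK : K :\: X \subset K by apply: subsetDl.
  have c0Y : c0 \in Y by rewrite inE eqxx rE /=.
  rewrite (cardsD1 c0 Y) c0Y ltnS -(card_in_imset (injcol _ DK)).
  apply: leq_trans (leq_imset_card box_row_ord (Y :\ c0)).
  apply: subset_leq_card; apply/fintype.subsetP => _ /imsetP[b + ->].
  rewrite !inE => /andP[+ /eqP bE]; rewrite bE eqxx /= -ltnNge => bL.
  have [d dr dc] : exists2 d : 'I_n, row d = row b & col d = col c0.
    by apply: (box_ex eta_sorted (b := c0)); rewrite -?rE // ltnW.
  apply/imsetP; exists d; last exact: val_inj.
  rewrite !inE dc dr eqxx (ltnW bL) !andbT /=.
  by apply/eqP => dE; move: bL; rewrite -dr dE rE ltnn.
move: leZ; rewrite ZE cardsU disjoint_setI0 // cards0 subn0 -(cardsID X K) (finset.setIidPr XK).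
by rewrite leq_add2l leqNgt => /negP.
Qed.

(** Two statistics that order the fillings: a Garnir exchange raises the column weight, while
    sorting a pair in a column keeps it and raises the row weight. *)
Definition col_weight t := (\sum_(b < n) col b * t b)%N.
Definition row_weight t := (\sum_(b < n) row b * t b)%N.

(** The weight grows by the product of [row c - row b] and [t b - t c]. *)
Lemma row_weight_swap t b c : col b = col c -> (row b < row c)%N -> (t c < t b)%N ->
  (row_weight t < row_weight (permute t (tperm b c)))%N.
Proof.
clear eta_sorted eta_pos.
move=> cE rL tL; have bc : c != b by apply: contraTneq rL => ->; rewrite ltnn.
rewrite /row_weight (bigD1 b) // (bigD1 c) //= [X in (_ < X)%N](bigD1 b) // (bigD1 c) //=.
rewrite !ffunE tpermL tpermR !addnA; set A := (X in (_ + X < _)%N); set A' := (X in (_ < _ + X)%N).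
have -> : A' = A.
  by apply: eq_bigr => d /andP[db dc]; rewrite ffunE tpermD // eq_sym.
rewrite ltn_add2r.
have [u -> ] : exists u, row c = (row b + u.+1)%N by exists (row c - row b).-1; lia.
have [v -> ] : exists v, t b = (t c + v.+1)%N :> nat by exists (t b - t c).-1; lia.
nia.
Qed.

Lemma col_weight_col_stab t q : q \in C -> col_weight (permute t q) = col_weight t.
Proof.
move/col_stabP=> qC; rewrite /col_weight [RHS](reindex_inj (@perm_inj _ q)) /=.
by apply: eq_bigr => b _; rewrite ffunE qC.
Qed.

Lemma row_weight_row_stab t p : p \in R -> row_weight (permute t p) = row_weight t.
Proof.
move/row_stabP=> pR; rewrite /row_weight [RHS](reindex_inj (@perm_inj _ p)) /=.
by apply: eq_bigr => b _; rewrite ffunE pR.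
Qed.

Lemma sum_setU (I : finType) (X Y : {set I}) (f : I -> nat) : [disjoint X & Y] ->
  (\sum_(b in X :|: Y) f b = \sum_(b in X) f b + \sum_(b in Y) f b)%N.
Proof. by move=> XY; rewrite -bigU //=; apply: eq_bigl => b; rewrite !inE. Qed.

(* [X] and [Y] lie in columns [c < c'] and all the entries in [X] exceed those
   in [Y], so moving a box of [Y] into [X] moves larger entries to the right. *)
Lemma col_weight_garnir t (X Y : {set 'I_n}) (c c' v : nat) s x :
  (c < c')%N -> [disjoint X & Y] ->
  {in X, forall b, col b = c /\ (v <= t b)%N} ->
  {in Y, forall b, col b = c' /\ (t b < v)%N} ->
  perm_on (X :|: Y) s -> x \in X -> s x \in Y ->
  (col_weight t < col_weight (permute t s))%N.
Proof.
clear eta_sorted eta_pos.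
move=> cL XY XP YP sZ xX sxY.
have split_sum (f : 'I_n -> nat) :
    (\sum_b f b = \sum_(b in X) f b + \sum_(b in Y) f b + \sum_(b | b \notin X :|: Y) f b)%N.
  rewrite (bigID (mem (X :|: Y))) /=; congr (_ + _)%N.
  by rewrite sum_setU.
have sumX (f : 'I_n -> nat) : (\sum_(b in X) col b * f b = c * \sum_(b in X) f b)%N.
  by rewrite big_distrr; apply: eq_bigr => b /XP[-> _].
have sumY (f : 'I_n -> nat) : (\sum_(b in Y) col b * f b = c' * \sum_(b in Y) f b)%N.
  by rewrite big_distrr; apply: eq_bigr => b /YP[-> _].
rewrite /col_weight !split_sum !sumX !sumY.
have -> : (\sum_(b | b \notin X :|: Y) col b * permute t s b =
           \sum_(b | b \notin X :|: Y) col b * t b)%N.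
  by apply: eq_bigr => b bZ; rewrite ffunE (out_perm sZ).
rewrite ltn_add2r.
have tot : (\sum_(b in X) t b + \sum_(b in Y) t b =
            \sum_(b in X) permute t s b + \sum_(b in Y) permute t s b)%N.
  rewrite -!sum_setU //=.
  rewrite (reindex_inj (@perm_inj _ s)) /=; apply: eq_big => [b|b _].
    by rewrite perm_closed.
  by rewrite ffunE.
have lt : (\sum_(b in X) permute t s b < \sum_(b in X) t b)%N.
  have E : (\sum_(b in X) t b = \sum_(b in X) v + \sum_(b in X :|: Y) (t b - v))%N.
    rewrite sum_setU //= [X in (_ + (_ + X))%N]big1 ?addn0 => [|b /YP[_ ?]]; last by lia.
    by rewrite -big_split /=; apply: eq_bigr => b /XP[_ ?]; rewrite subnKC.
  have ES : (\sum_(b in X :|: Y) (t b - v) = \sum_(b in X :|: Y) (t (s b) - v))%N.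
    by rewrite (reindex_inj (@perm_inj _ s)) /=; apply: eq_bigl => b; rewrite perm_closed.
  rewrite E ES; apply: (@leq_trans (\sum_(b in X) v + \sum_(b in X) (t (s b) - v))%N); last first.
    by rewrite leq_add2l sum_setU // leq_addr.
  rewrite -big_split /= (bigD1 x) //= [X in (_ < X)%N](bigD1 x) //= -addSn.
  apply: leq_add; first by rewrite ffunE; have [_ ?] := YP _ sxY; lia.
  by apply: leq_sum => b _; rewrite ffunE; lia.
move: tot lt; set a := (\sum_(b in X) t b)%N; set d := (\sum_(b in Y) t b)%N.
set a' := (\sum_(b in X) permute t s b)%N; set d' := (\sum_(b in Y) permute t s b)%N.
move=> tot lt.
have [u aE] : exists u, a = (a' + u.+1)%N by exists (a - a').-1; lia.
have dE : d' = (d + u.+1)%N by lia.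
have [w cE] : exists w, c' = (c + w.+1)%N by exists (c' - c).-1; lia.
rewrite aE dE cE; nia.
Qed.

Lemma perm_on_setU_stable (X Y : {set 'I_n}) s : [disjoint X & Y] -> perm_on (X :|: Y) s ->
  {in X, forall x, s x \in X} -> {in Y, forall y, s y \in Y}.
Proof.
move=> XY sZ sX y yY; have sy : s y \in X :|: Y by rewrite perm_closed // inE yY orbT.
have sXE : s @: X = X.
  apply/eqP; rewrite eqEcard card_imset; last exact: perm_inj.
  by rewrite leqnn andbT; apply/fintype.subsetP => _ /imsetP[x /sX ? ->].
move: sy; rewrite inE => /orP[|//]; rewrite -{1}sXE => /imsetP[x xX /perm_inj yx].
by have := disjointFr XY xX; rewrite -yx yY.
Qed.

(** Descending induction on a bounded weight. A repeated entry in a column gives 0, an inversion in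
    a column is exchanged up to sign, and a descent in a row is rewritten by a Garnir relation into
    fillings of larger weight. *)
Lemma polytabloid_semistandard_span (U : {vspace T}) :
  (forall S, semistandard S -> polytabloid S \in U) -> forall t, polytabloid t \in U.
Proof.
(* [K] exceeds every row weight, so [w] compares the column weight first and the row weight
   second. *)
move=> US; pose K := (\sum_(b < n) row b * n).+1.
have rwL t : (row_weight t < K)%N.
  by rewrite ltnS; apply: leq_sum => b _; rewrite leq_mul2l (ltnW (ltn_ord (t b))) orbT.
pose w t := (col_weight t * K + row_weight t)%N.
have [B wB] : exists B, forall t, (w t <= B)%N.
  by exists (\max_t w t) => t; apply: leq_bigmax.
suff H m t : (B - w t < m)%N -> polytabloid t \in U by move=> t; apply: (H (B - w t).+1).
elim: m t => // m IH t wm.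
have step t' : (w t < w t')%N -> polytabloid t' \in U.
  by move=> wt; apply: IH; have := wB t'; lia.
have [cs|] := boolP [forall b : 'I_n, forall c : 'I_n, (col b == col c) && (row b < row c)%N ==> (t b < t c)%N];
  last first.
  rewrite negb_forall => /existsP[b]; rewrite negb_forall => /existsP[c]; rewrite negb_imply -leqNgt => /andP[/andP[/eqP cE rL] tL].
  have bc : b != c by apply: contraTneq rL => ->; rewrite ltnn.
  move: tL; rewrite leq_eqVlt => /predU1P[/val_inj tE|tL].
    by rewrite (polytabloid_eq0 _ bc cE) ?mem0v.
  have := polytabloid_col F t (tperm_col_stab cE).
  rewrite odd_tperm bc expr1 scaleN1r => /(canLR opprK) <-; rewrite memvN step //.
  by rewrite /w col_weight_col_stab ?tperm_col_stab // ltn_add2l row_weight_swap.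
have {}cs b c : col b = col c -> (row b < row c)%N -> (t b < t c)%N.
  by move=> cE rL; have /forallP/(_ b)/forallP/(_ c) := cs; rewrite cE rL eqxx.
have [rw|] := boolP [forall b : 'I_n, forall c : 'I_n, (row b == row c) && (col b < col c)%N ==> (t b <= t c)%N].
  apply: US; apply/semistandardP; split=> // b c rE cL.
  by have /forallP/(_ b)/forallP/(_ c) := rw; rewrite rE cL eqxx.
rewrite negb_forall => /existsP[b0]; rewrite negb_forall => /existsP[c0]; rewrite negb_imply -ltnNge => /andP[/andP[/eqP rE cL] tL].
pose X := [set b : 'I_n | (col b == col b0) && (row b0 <= row b)%N].
pose Y := [set b : 'I_n | (col b == col c0) && (row b <= row b0)%N].
have XY : [disjoint X & Y].
  apply/pred0P => b /=; rewrite !inE; apply/negbTE/negP => /andP[/andP[/eqP-> _]].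
  by case/andP => /eqP E _; rewrite E ltnn in cL.
have XP : {in X, forall b, col b = col b0 /\ (t b0 <= t b)%N}.
  move=> b; rewrite inE => /andP[/eqP cE]; rewrite leq_eqVlt => /predU1P[E|L].
    by split=> //; rewrite (@box_inj eta b0 b).
  by split=> //; rewrite ltnW // cs.
have YP : {in Y, forall b, col b = col c0 /\ (t b < t b0)%N}.
  move=> b; rewrite inE => /andP[/eqP cE]; rewrite rE leq_eqVlt => /predU1P[E|L].
    by split=> //; rewrite (@box_inj eta b c0).
  by split=> //; apply: ltn_trans tL; rewrite cs.
have := garnir F t (garnir_pigeonhole rE cL (erefl (X :|: Y))).
rewrite (bigID (fun s => [forall x in X, s x \in X])) /=.
move/eqP; rewrite addr_eq0 => /eqP gE.
(* In the Garnir relation, a permutation moving some box of [X] into [Y] raises the column weight.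
   The others preserve [X] and [Y], hence the columns, and each contributes [polytabloid t]
   itself. *)
have : \sum_(s | perm_on (X :|: Y) s && [forall x in X, s x \in X])
          (-1) ^+ s *: polytabloid (permute t s) \in U.
  rewrite gE memvN; apply: memv_suml => s /andP[sZ].
  case/forall_inPn => x xX sx; apply: memvZ; apply: step.
  have sxY : s x \in Y.
    have : s x \in X :|: Y by rewrite perm_closed // inE xX.
    by rewrite inE (negPf sx).
  have := col_weight_garnir cL XY XP YP sZ xX sxY.
  by rewrite /w; have := rwL t; set r := row_weight t; set r' := row_weight _;
     set k := col_weight t; set k' := col_weight _; nia.
have E s : perm_on (X :|: Y) s && [forall x in X, s x \in X] ->
    (-1) ^+ s *: polytabloid (permute t s) = polytabloid t.
  case/andP => sZ /forall_inP sX.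
  have sY := perm_on_setU_stable XY sZ sX.
  rewrite polytabloid_col ?scalerA -?expr2 ?sqrr_sign ?scale1r //.
  apply/col_stabP => b; have [bX|bX] := boolP (b \in X).
    by have [-> _] := XP _ (sX _ bX); have [-> _] := XP _ bX.
  have [bY|bY] := boolP (b \in Y).
    by have [-> _] := YP _ (sY _ bY); have [-> _] := YP _ bY.
  by rewrite (out_perm sZ) // inE negb_or bX bY.
rewrite (eq_bigr (fun=> polytabloid t)) //.
rewrite sumr_const -scaler_nat => H.
(* The multiplicity of [polytabloid t] is a positive integer, as the identity is counted, so it can
   be inverted. *)
rewrite -[polytabloid t](scalerK (a := (#|[pred s | perm_on (X :|: Y) s && [forall x in X, s x \in X]]|)%:R)).
  by apply: memvZ.
rewrite pnatr_eq0 -lt0n; apply/card_gt0P; exists 1%g; rewrite inE perm_on1.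
by apply/forall_inP => x xX; rewrite perm1.
Qed.

End Straightening.

(** * The semistandard basis *)

Section SemistandardBasis.
Variables (F : numFieldType) (eta : seq nat).
Hypothesis eta_sorted : sorted geq eta.
Hypothesis eta_pos : 0%N \notin eta.
Local Notation n := (sumn eta).
Local Notation row := (box_row eta).
Local Notation col := (box_col eta).
Local Notation R := (row_stab n eta).
Local Notation C := (col_stab n eta).
Local Notation T := (tensor F n).
Local Notation polytabloid := (@polytabloid F eta).
Local Notation row_sym := (row_sym F eta).
Local Notation col_alt := (col_alt F eta).
Implicit Types (t j S : multi_index n) (s p q : 'S_n) (b c : 'I_n).

(* In a column-strict filling, the row of a box is the number of smaller
   entries in its column. *)
Lemma column_strict_perm t q : column_strict t -> q \in C ->
  column_strict (permute t q) -> q = 1%g.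
Proof.
move=> ct /[dup] qC /col_stabP qCE cq.
have above u : column_strict u -> forall b,
    [set b' : 'I_n | (col b' == col b) && (row b' < row b)%N] =
    [set b' : 'I_n | (col b' == col b) && (u b' < u b)%N].
  move=> cu b; apply/setP => b'; rewrite !inE; have [cE|//] := eqVneq (col b') (col b).
  apply/idP/idP => /= [/cu->//|]; apply: contraTT; rewrite -!leqNgt leq_eqVlt.
  by case/predU1P=> [/box_inj->//|/cu L]; apply/ltnW/L.
have cardE b : #|[set b' : 'I_n | (col b' == col b) && (row b' < row b)%N]| =
    #|[set b' : 'I_n | (col b' == col (q b)) && (row b' < row (q b))%N]|.
  rewrite (above _ cq) (above _ ct) -(card_imset _ (@perm_inj _ q)).
  apply: eq_card => d; rewrite inE; apply/imsetP/idP.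
    by case=> b'; rewrite inE !ffunE => /andP[/eqP bE L] ->; rewrite !qCE bE eqxx.
  move=> H; exists (q^-1 d)%g; rewrite ?permKV // inE !ffunE permKV.
  by have := qCE (q^-1 d)%g; rewrite permKV => <-; rewrite -(qCE b).
apply/permP => b; rewrite perm1; apply: box_inj; last exact: qCE.
have lt_card b' c' : col b' = col c' -> (row b' < row c')%N ->
    (#|[set d : 'I_n | (col d == col b') && (row d < row b')%N]| <
     #|[set d : 'I_n | (col d == col c') && (row d < row c')%N]|)%N.
  move=> cE rL; apply: proper_card; apply/fintype.properP; split.
    by apply/fintype.subsetP => d; rewrite !inE cE => /andP[-> /= /ltn_trans]; apply.
  by exists b'; rewrite !inE ?cE ?eqxx ?rL // ltnn andbF.
case: (ltngtP (row (q b)) (row b)) => // L.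
  by have := lt_card _ _ (qCE b) L; rewrite (cardE b) ltnn.
by have := lt_card _ _ (esym (qCE b)) L; rewrite (cardE b) ltnn.
Qed.

(** A column rearrangement of maximal row weight is column strict, otherwise exchanging an inversion
    would raise the weight. By [column_strict_perm] it is then the identity. *)
Lemma column_strict_max t q : column_strict t -> q \in C ->
  (row_weight t <= row_weight (permute t q))%N -> q = 1%g.
Proof.
move=> ct qC wL.
have inj u : (exists2 q', q' \in C & u = permute t q') -> forall b c,
   col b = col c -> b != c -> u b != u c.
  case=> q' /col_stabP q'C -> b c cE bc; rewrite !ffunE.
  have cE' : col (q' b) = col (q' c) by rewrite !q'C.
  have bc' : q' b != q' c by rewrite (inj_eq perm_inj).
  case: (ltngtP (row (q' b)) (row (q' c))) => L.
  - by apply/eqP => E; have := ct _ _ cE' L; rewrite E ltnn.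
  - by apply/eqP => E; have := ct _ _ (esym cE') L; rewrite E ltnn.
  - by rewrite (box_inj L cE') eqxx in bc'.
have max_strict q' : q' \in C ->
    (forall q2, q2 \in C -> row_weight (permute t q2) <= row_weight (permute t q'))%N ->
    q' = 1%g.
  move=> q'C mx; apply: (column_strict_perm ct) => // b c cE rL.
  rewrite ltnNge; apply/negP; rewrite leq_eqVlt => /predU1P[/val_inj E|L].
    have bc : b != c by apply: contraTneq rL => ->; rewrite ltnn.
    by have := inj _ (ex_intro2 _ _ q' q'C (erefl _)) _ _ cE bc; rewrite E eqxx.
  have := row_weight_swap cE rL L; rewrite permuteM ltnNge mx //.
  by rewrite col_stabMl // tperm_col_stab.
case: (@arg_maxnP _ 1%g (mem C) (fun q' => row_weight (permute t q')) (col_stab1 eta)) => q0 q0C mx.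
have q01 := max_strict q0 q0C mx.
by apply: max_strict => // q2 /mx le2; apply: leq_trans le2 _; rewrite q01 permute1.
Qed.

(** A row has a single weakly increasing rearrangement: the entry of [b] is at most [v] exactly when
    the entries of its row that are at most [v] outnumber the boxes to the left of [b]. *)
Lemma row_weak_perm t p : row_weak t -> p \in R -> row_weak (permute t p) ->
  permute t p = t.
Proof.
move=> rt /row_stabP pR rp.
have val_le u : row_weak u -> forall b (v : nat), (u b <= v)%N =
    (#|[set d : 'I_n | (row d == row b) && (col d < col b)%N]| <
     #|[set d : 'I_n | (row d == row b) && (u d <= v)%N]|)%N.
  move=> ru b v; apply/idP/idP => [ub|].
    apply: proper_card; apply/fintype.properP; split.
      apply/fintype.subsetP => d; rewrite !inE => /andP[/eqP rE L]; rewrite rE eqxx /=.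
      exact: leq_trans (ru _ _ rE L) ub.
    by exists b; rewrite !inE eqxx //= ltnn.
  apply: contraTT; rewrite -leqNgt -ltnNge => vu; apply: subset_leq_card.
  apply/fintype.subsetP => d; rewrite !inE => /andP[/eqP rE L]; rewrite rE eqxx /= ltnNge leq_eqVlt.
  apply/negP => /predU1P[/esym cE|cL].
    by move: L; rewrite (box_inj rE cE) leqNgt vu /=.
  by have := leq_trans (ru _ _ (esym rE) cL) L; rewrite leqNgt vu /=.
apply/ffunP => b; apply/val_inj/eqP; rewrite /= eqn_leq.
have E v : (permute t p b <= v)%N = (t b <= v)%N.
  rewrite (val_le _ rp) (val_le _ rt); congr (_ < _)%N.
  rewrite -(card_imset _ (@perm_inj _ p)); apply: eq_card => d; rewrite inE; apply/imsetP/idP.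
    by case=> b'; rewrite inE !ffunE => /andP[/eqP bE L] ->; rewrite !pR bE eqxx.
  move=> H; exists (p^-1 d)%g; rewrite ?permKV // inE !ffunE permKV.
  by have := pR (p^-1 d)%g; rewrite permKV => <-.
by rewrite E leqnn -E leqnn.
Qed.

(** Triangularity with respect to the row weight. Row permutations of [S] keep its weight, so by
    [column_strict_max] only the trivial column permutation contributes. *)
Lemma polytabloid_coef S t : semistandard S -> semistandard t ->
  (row_weight t <= row_weight S)%N ->
  polytabloid t S = (#|[set p in R | permute S p == S]| * (t == S))%:R.
Proof.
move=> /semistandardP[rS cS] /semistandardP[rt ct] wL; rewrite polytabloidE.
transitivity (\sum_(p in R) (permute S p == t)%:R : F).
  apply: eq_bigr => p pR; rewrite (bigD1 1%g) ?col_stab1 //= odd_perm1 mul1r permute1.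
  rewrite big1 ?addr0 // => q /andP[qC q1].
  case: eqP => [E|]; last by rewrite mulr0.
  have qVC : (q^-1 \in C)%g by rewrite col_stabV.
  have : (q^-1)%g = 1%g.
    apply: (column_strict_max ct) => //; rewrite -{2}E permuteK.
    by rewrite row_weight_row_stab.
  by move/eqP; rewrite invg_eq1 (negPf q1).
rewrite -natr_sum; congr _%:R; have [->|tS] := eqVneq t S.
  by rewrite muln1 -sum1_card [RHS]big_mkcond [LHS]big_mkcond; apply: eq_bigr => p _;
     rewrite inE; case: (p \in R); case: eqP.
rewrite muln0; apply: big1 => p pR; case: eqP => // E; case/eqP: tS.
by rewrite -E row_weak_perm // E.
Qed.

Definition ssyt_seq := enum [pred t : multi_index n | semistandard t].
Definition ssyt_basis : (size ssyt_seq).-tuple T := map_tuple polytabloid (in_tuple ssyt_seq).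

Lemma ssyt_basis_free : free ssyt_basis.
Proof.
apply/freeP => k k0 i.
have nthE (i0 : 'I_(size ssyt_seq)) : ssyt_basis`_i0 = polytabloid (tnth (in_tuple ssyt_seq) i0).
  by rewrite -tnth_nth tnth_map.
have ssT (i0 : 'I_(size ssyt_seq)) : semistandard (tnth (in_tuple ssyt_seq) i0).
  by have := mem_tnth i0 (in_tuple ssyt_seq); rewrite mem_enum.
apply/eqP; apply: contraT => ki.
pose w (i0 : 'I_(size ssyt_seq)) := row_weight (tnth (in_tuple ssyt_seq) i0).
(* At a tableau of maximal row weight among those with nonzero coefficient, the relation reduces to
   its own term. *)
case: (@arg_maxnP _ i (fun i0 => k i0 != 0) w ki) => m km mx.
have /ffunP/(_ (tnth (in_tuple ssyt_seq) m)) := k0.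
rewrite sum_ffunE ffunE (bigD1 m) //= big1 => [|i0 im].
  rewrite addr0 ffunE nthE polytabloid_coef ?ssT // eqxx muln1 => /eqP.
  rewrite mulf_eq0 (negPf km) pnatr_eq0 /= cards_eq0 => /eqP/setP/(_ 1%g).
  by rewrite !inE permute1 eqxx andbT => /negP[]; apply/forallP => b; rewrite perm1.
rewrite ffunE; have [->|ki0] := eqVneq (k i0) 0; first by rewrite [LHS]mul0r.
rewrite nthE polytabloid_coef; [|exact: ssT|exact: ssT|exact: mx].
case: eqP => [E|]; last by rewrite muln0 scaler0.
by case/eqP: im; apply: (elimT (tuple_uniqP (in_tuple ssyt_seq)) (enum_uniq _)).
Qed.

Definition young_op : 'End(T) := (row_sym \o col_alt)%VF.

Lemma young_op_basis t : young_op (tensor_basis F t) = polytabloid t.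
Proof. by rewrite comp_lfunE. Qed.

Lemma ssyt_basisP : basis_of (limg young_op) ssyt_basis.
Proof.
rewrite basisEfree ssyt_basis_free /=.
have mem_ss t : semistandard t -> polytabloid t \in <<ssyt_basis>>%VS.
  by move=> ss; apply: memv_span; apply: map_f; rewrite mem_enum.
have sub1 : (<<ssyt_basis>> <= limg young_op)%VS.
  apply/span_subvP => _ /mapP[t _ ->]; rewrite /polytabloid -comp_lfunE.
  by rewrite memv_img ?memvf.
have sub2 : (limg young_op <= <<ssyt_basis>>)%VS.
  apply/subvP => _ /memv_imgP[x _ ->]; rewrite [x]tensor_sum linear_sum.
  apply: memv_suml => t _; rewrite linearZ; apply: memvZ.
  rewrite [X in X \in _]young_op_basis.
  exact: (polytabloid_semistandard_span eta_sorted eta_pos mem_ss).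
rewrite sub1 /=; apply: leq_trans (dimvS sub2) _.
by rewrite (eqP ssyt_basis_free).
Qed.

Lemma young_op_tpow A x : young_op (tpow A x) = tpow A (young_op x).
Proof. by rewrite !comp_lfunE /= !group_op_tpow. Qed.

(** Each basis vector is the image of a basis tensor, hence a weight vector whose eigenvalue is the
    monomial of its tableau. *)
Lemma trace_young_op_diag (d : 'rV[F]_n) :
  trace_on (limg young_op) (tpow (diag_mx d)) = schur eta (fun i => d 0 i).
Proof.
rewrite (trace_on_diag (a := fun i => \prod_b d 0 (tnth (in_tuple ssyt_seq) i b)) ssyt_basisP).
  rewrite /schur -[RHS]big_enum /= -/ssyt_seq.
  by rewrite -[in RHS](in_tupleE ssyt_seq) big_tuple.
move=> i; set t := tnth _ i.
have -> : ssyt_basis`_i = young_op (tensor_basis F t).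
  by rewrite -tnth_nth tnth_map comp_lfunE.
rewrite -young_op_tpow -linearZ /=; congr (young_op _); apply/ffunP => j.
rewrite tpow_diag ![in RHS]ffunE ffunE; case: eqP => [->//|_].
by rewrite mulr0 [RHS]mulr0.
Qed.

End SemistandardBasis.

(** * The Schur polynomial as a character *)

Lemma trace_tpow_conj (F : fieldType) n (U : {vspace tensor F n}) (A P Q : 'M[F]_n) :
  (forall B x, x \in U -> tpow B x \in U) -> Q *m P = 1%:M ->
  trace_on U (tpow (P *m A *m Q)) = trace_on U (tpow A).
Proof.
move=> US QP; have PQ : P *m Q = 1%:M by apply: mulmx1C.
apply: (@trace_on_iso _ _ _ _ _ _ (tpow Q)).
- apply/eqP; rewrite -subv0; apply/subvP => y; rewrite memv_cap memv_ker memv0.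
  by case/andP => _ /eqP E; rewrite -[y]tpow1 -PQ tpowM E linear0.
- apply/eqP; rewrite eqEsubv; apply/andP; split; apply/subvP => y.
    by case/memv_imgP => x xU ->; apply: US.
  by move=> yU; rewrite -[y]tpow1 -QP tpowM memv_img // US.
- by move=> x; apply: US.
- by move=> x xU; rewrite -!tpowM !mulmxA QP mul1mx.
Qed.

Lemma coord_pairing (F : fieldType) n m (X : m.-tuple (tensor F n)) i x :
  coord X i x = pairing (fun j => coord X i (tensor_basis F j)) x.
Proof.
rewrite {1}[x]tensor_sum linear_sum; apply: eq_bigr => j _.
by rewrite linearZ [LHS]mulrC.
Qed.

Section CharacterFormula.
Variables (F : numClosedFieldType) (eta : seq nat).
Hypothesis eta_sorted : sorted geq eta.
Hypothesis eta_pos : 0%N \notin eta.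
Local Notation n := (sumn eta).
Local Notation T := (tensor F n).
Local Notation "P @ t" := (map_mx (horner_eval t) P).
Local Notation N := (limg (young_op F eta)).

Let NS B x : x \in N -> tpow B x \in N.
Proof. by case/memv_imgP => y _ ->; rewrite -young_op_tpow memv_img ?memvf. Qed.

Lemma trace_tpow_poly (U : {vspace T}) (P : 'M[{poly F}]_n) :
  exists p : {poly F}, forall t, p.[t] = trace_on U (tpow (P @ t)).
Proof.
have /fin_all_exists[p pE] (i : 'I_(\dim U)) : exists p : {poly F}, forall t,
    p.[t] = coord (vbasis U) i (tpow (P @ t) (vbasis U)`_i).
  have [p pE] := tpow_poly (fun j => coord (vbasis U) i (tensor_basis F j)) (vbasis U)`_i P.
  by exists p => t; rewrite pE coord_pairing.
by exists (\sum_i p i) => t; rewrite horner_sum; apply: eq_bigr => i _.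
Qed.

(* Conjugating by [diag (1, t, t^2, ...)] multiplies the entry [(i, j)] by
   [t ^ (i - j)], and [t] can be sent to 0. *)
Lemma trace_tpow_trig (B : 'M[F]_n) : is_trig_mx B ->
  trace_on N (tpow B) = schur eta (fun i => B i i).
Proof.
move=> /is_trig_mxP trB.
pose P := \matrix_(i < n, j < n) (if (j <= i)%N then B i j *: 'X^(i - j) else 0 : {poly F}).
have [p pE] := trace_tpow_poly N P.
have /eqP : p - (trace_on N (tpow B))%:P = 0.
  apply: (@poly_nat_eq0 _ _ 'X); first by rewrite polyX_eq0.
  move=> k; rewrite hornerX => k0; apply/eqP; rewrite !hornerE subr_eq0 pE; apply/eqP.
  pose d := \row_(i < n) (k%:R ^+ i : F).
  pose d' := \row_(i < n) (k%:R ^- i : F).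
  rewrite -(@trace_tpow_conj _ _ _ B (diag_mx d) (diag_mx d') NS); last first.
    apply/matrixP => i j; rewrite mul_diag_mx !mxE.
    case: eqP => [->|_]; last by rewrite mulr0.
    by rewrite mulr1n mulVf // expf_neq0.
  congr (trace_on _ (tpow _)); apply/matrixP => i j.
  rewrite mul_mx_diag mul_diag_mx !mxE /horner_eval; case: leqP => ji.
    have -> : k%:R ^- j = k%:R ^+ (i - j) / k%:R ^+ i :> F.
      by rewrite -[X in _ / _ ^+ X](subnK ji) exprD invfM mulrA mulfV ?mul1r ?expf_neq0.
    by rewrite hornerZ hornerXn [_ ^+ i * _]mulrC -mulrA; congr (_ * _); rewrite mulrCA mulfV ?mulr1 ?expf_neq0.
  by rewrite horner0 trB // mulr0 mul0r.
rewrite subr_eq0 => /eqP pC.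
have : p.[0] = trace_on N (tpow B) by rewrite pC hornerC.
move<-; rewrite pE.
rewrite -[RHS](_ : schur eta (fun i => (\row_i B i i) 0 i) = _); last first.
  by apply: eq_bigr => t _; apply: eq_bigr => b _; rewrite mxE.
rewrite -(trace_young_op_diag eta_sorted eta_pos); congr (trace_on _ (tpow _)).
apply/matrixP => i j; rewrite !mxE /horner_eval.
case: (ltngtP j i) => [ji|ij|/val_inj ->].
- rewrite hornerZ hornerXn -[(i - j)%N]prednK ?subn_gt0 // expr0n mulr0.
  by rewrite -val_eqE /= gtn_eqF.
- by rewrite horner0 -val_eqE /= ltn_eqF.
- by rewrite eqxx subnn expr0 alg_polyC hornerC.
Qed.

(** Symmetry is read off the trace: conjugation by a permutation matrix permutes a diagonal. It
    makes the order in which [eigenvalues] lists the roots irrelevant. *)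
Lemma schur_perm (x : 'I_n -> F) (s : 'S_n) :
  schur eta (fun i => x (s i)) = schur eta x.
Proof.
have E y : schur eta y = trace_on N (tpow (diag_mx (\row_i y i))).
  rewrite (trace_young_op_diag eta_sorted eta_pos).
  by apply: eq_bigr => t _; apply: eq_bigr => b _; rewrite mxE.
rewrite !E -(@trace_tpow_conj _ _ _ (diag_mx (\row_i x i)) (perm_mx s) (perm_mx s^-1) NS).
  congr (trace_on _ (tpow _)); rewrite -row_permE -col_permE; apply/matrixP => i j.
  by rewrite !mxE (inj_eq perm_inj).
by rewrite -perm_mxM mulVg perm_mx1.
Qed.

Theorem trace_young_op (A : 'M[F]_n) :
  trace_on N (tpow A) = schur_mx eta A.
Proof.
(* Unitary triangularization by [Schur] asks for a positive dimension; the empty matrix is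
   diagonal. *)
have [n0|n0] := posnP n.
  rewrite -[A](_ : diag_mx (\row_i A i i) = A); last first.
    by apply/matrixP => i; have := ltn_ord i; rewrite {2}n0.
  rewrite (trace_young_op_diag eta_sorted eta_pos).
  by apply: eq_bigr => t _; apply: eq_bigr => b _; have := ltn_ord b; rewrite {2}n0.
have [P Pu trP] := Schur A n0.
set B := conjmx P A; have trB : is_trig_mx B by exact: trP.
have PE : B = P *m A *m P^t* by rewrite /B conjymx.
have PP' : P *m P^t* = 1%:M by apply/unitarymxP.
have PP : P^t* *m P = 1%:M by apply: mulmx1C.
rewrite -(trace_tpow_conj A NS PP) -PE trace_tpow_trig //.
set Q := (P^t*)%sesqui in PE PP' PP.
have charE : char_poly A = char_poly B.
  have pP'P : map_mx polyC Q *m map_mx polyC P = 1%:M by rewrite -map_mxM PP map_mx1.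
  have pPP' : map_mx polyC P *m map_mx polyC Q = 1%:M by rewrite -map_mxM PP' map_mx1.
  rewrite /char_poly /char_poly_mx PE !map_mxM.
  transitivity (\det (map_mx polyC P *m ('X%:M - map_mx polyC A) *m map_mx polyC Q)).
    by rewrite !det_mulmx mulrC mulrA -det_mulmx pP'P det1 mul1r.
  congr (\det _); rewrite mulmxBr mulmxBl; congr (_ - _).
  by rewrite scalar_mxC -mulmxA pPP' mulmx1.
have eigE : perm_eq (eigenvalues A) [tuple B i i | i < n].
  apply: prod_XsubC_eq; rewrite /eigenvalues.
  case: closed_field_poly_normal => r /= rE.
  have := rE; rewrite {1}charE char_poly_trig // (eqP (char_poly_monic A)) scale1r => <-.
  by rewrite big_map big_enum.
have [s sE] := tuple_permP eigE.
rewrite /schur_mx -(schur_perm _ s); apply: eq_bigr => t _; apply: eq_bigr => b _.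
by rewrite sE -tnth_nth !tnth_mktuple.
Qed.

End CharacterFormula.

(** * Polarization *)

Lemma sum_digits_inj m B (x y : 'I_m -> nat) :
  (forall i, x i < B)%N -> (forall i, y i < B)%N ->
  (\sum_(i < m) x i * B ^ i = \sum_(i < m) y i * B ^ i)%N -> x =1 y.
Proof.
elim: m x y => [|m IH] x y xB yB; first by move=> _ [].
have B0 : (0 < B)%N by apply: leq_ltn_trans (xB ord0).
rewrite !big_ord_recl !expn0 !muln1 => E.
have shift (z : 'I_m.+1 -> nat) : (\sum_(i < m) z (lift ord0 i) * B ^ lift ord0 i =
    (\sum_(i < m) z (lift ord0 i) * B ^ i) * B)%N.
  by rewrite big_distrl; apply: eq_bigr => i _; rewrite lift0 expnSr mulnA.
rewrite !shift in E.
have E0 : x ord0 = y ord0.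
  have := congr1 (modn^~ B) E.
  by rewrite /= ![(_ + _ * B)%N]addnC !modnMDl !modn_small.
move: E; rewrite E0 => /addnI /eqP; rewrite eqn_pmul2r // => /eqP /IH E i.
by case: (unliftP ord0 i) => [j|] -> //; apply: E => k.
Qed.

(* The digits in base [n.+1] count the occurrences of each value of [f], so
   the weight determines [f] up to a permutation. *)
Definition code_weight n (K : finType) (f : 'I_n -> K) : nat :=
  (\sum_k n.+1 ^ enum_rank (f k))%N.

Lemma code_weight_perm n (K : finType) (f g : 'I_n -> K) :
  code_weight f = code_weight g -> exists p : 'S_n, forall k, f k = g (p k).
Proof.
have digits (h : 'I_n -> K) :
    code_weight h = (\sum_(i < #|K|) #|[set k | h k == enum_val i]| * n.+1 ^ i)%N.
  rewrite /code_weight (partition_big (fun k => enum_rank (h k)) xpredT) //=.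
  apply: eq_bigr => i _; rewrite -sum_nat_const; apply: eq_big => [k|k /eqP -> //].
  by rewrite inE (can2_eq enum_rankK enum_valK).
rewrite !digits => /sum_digits_inj E.
have bound (h : 'I_n -> K) (i : 'I_#|K|) : (#|[set k | h k == enum_val i]| < n.+1)%N.
  by rewrite ltnS -[X in (_ <= X)%N]card_ord max_card.
have {}E := E (bound f) (bound g).
have : perm_eq [tuple f k | k < n] [tuple g k | k < n].
  have countE (h : 'I_n -> K) x : count_mem x [tuple h k | k < n] = #|[set k | h k == x]|.
    rewrite /= count_map cardE /enum_mem size_filter count_filter.
    by apply: eq_count => k; rewrite /= !inE andbT.
  apply/allP => x _ /=; rewrite [X in X == _]countE [X in _ == X]countE.
  by have := E (enum_rank x); rewrite enum_rankK => ->.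
case/tuple_permP => p pE; exists p => k.
have := congr1 (fun s => nth (f k) s k) pE.
by rewrite -!tnth_nth !tnth_mktuple.
Qed.

Section RowFilling.
Variables (F : numFieldType) (eta : seq nat).
Hypothesis eta_sorted : sorted geq eta.
Hypothesis eta_pos : 0%N \notin eta.
Local Notation n := (sumn eta).
Local Notation row := (box_row eta).
Local Notation col := (box_col eta).
Local Notation R := (row_stab n eta).
Local Notation C := (col_stab n eta).
Local Notation T := (tensor F n).
Local Notation row_sym := (row_sym F eta).
Local Notation col_alt := (col_alt F eta).
Implicit Types (t j : multi_index n) (s p q : 'S_n) (b c : 'I_n).

Definition row_filling : multi_index n := [ffun b => box_row_ord eta_pos b].
Local Notation e_row := (tensor_basis F row_filling).

Lemma row_filling_stab q : (permute row_filling q == row_filling) = (q \in R).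
Proof.
apply/eqP/row_stabP => [/ffunP E b|qR].
  by have := E b; rewrite !ffunE => /(congr1 val).
by apply/ffunP => b; rewrite !ffunE; apply: val_inj; apply: qR.
Qed.

Lemma row_sym_row_filling : row_sym e_row = #|R|%:R *: e_row.
Proof.
apply/ffunP => j; rewrite row_symE [RHS]ffunE.
transitivity (\sum_(p in R) e_row j); last by rewrite sumr_const -[LHS]mulr_natl.
apply: eq_bigr => p pR; rewrite !ffunE.
rewrite -(inj_eq (can_inj (@permuteK _ p^-1))) permuteK.
by have := row_filling_stab p^-1; rewrite row_stabV pR => /eqP->.
Qed.

Lemma tpow_row_filling g j :
  (tpow g e_row) j = \prod_k g (j k) (row_filling k).
Proof.
rewrite tpowE (bigD1 row_filling) //= [X in _ + X]big1 => [|i ne].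
  by rewrite addr0 ffunE eqxx [LHS]mulr1.
by rewrite ffunE (negPf ne) mulr0.
Qed.

(* Kronecker substitution: for the matrix whose entry at [v] is [t] to the power
   [n.+1 ^ enum_rank v], distinct monomials take distinct powers of [t]. *)
Lemma pairing_row_sym (c : multi_index n -> F) (x : T) :
  (forall g, pairing c (tpow g e_row) = 0) -> pairing c (row_sym x) = 0.
Proof.
move=> c0; pose e j := code_weight (fun k => (j k, row_filling k)).
have pol0 : \sum_j c j *: 'X^(e j) = 0.
  apply: (@poly_nat_eq0 _ _ 1); first exact: oner_neq0.
  move=> k _; have := c0 (\matrix_(v, r) k%:R ^+ (n.+1 ^ enum_rank (v, r))).
  move<-; rewrite horner_sum; apply: eq_bigr => j _.
  rewrite hornerZ hornerXn tpow_row_filling; congr (_ * _).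
  rewrite /e /code_weight expr_sum; apply: eq_bigr => l _; rewrite mxE //.
(* A power of ['X] collects the indices with one code; [eR] and [eRV] show that these form an orbit
   of [R]. *)
have class0 i : \sum_(j | e j == e i) c j = 0.
  have := congr1 (fun p : {poly F} => p`_(e i)) pol0; rewrite coef0 coef_sum => E0.
  rewrite -[RHS]E0 [LHS]big_mkcond; apply: eq_bigr => j _; rewrite coefZ coefXn eq_sym.
  by case: eqP; rewrite ?mulr1 ?mulr0.
have eR i p : p \in R -> e (permute i p) = e i.
  move=> pR; rewrite /e /code_weight [RHS](reindex_inj (@perm_inj _ p)) /=.
  apply: eq_bigr => k _; congr (_ ^ enum_rank (_, _))%N; rewrite ffunE //.
  by apply/val_inj; rewrite !ffunE /=; symmetry; apply/row_stabP.
have eRV i j : e j = e i -> exists2 p, p \in R & j = permute i p.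
  case/code_weight_perm => p pE; exists p.
    rewrite -row_filling_stab; apply/eqP/ffunP => k.
    by have [_ E] := pE k; rewrite ffunE -E.
  by apply/ffunP => k; have [E _] := pE k; rewrite ffunE -E.
rewrite [x]tensor_sum linear_sum.
under eq_bigr do rewrite linearZ.
rewrite pairing_sum big1 // => i _.
(* [row_sym] sends a basis tensor to the sum of its orbit, multiplied by the order of its stabilizer
   in [R]. *)
suff -> : pairing c (row_sym (tensor_basis F i)) =
    \sum_(j | e j == e i) #|[set p in R | permute i p == i]|%:R * c j.
  by rewrite -mulr_sumr class0 !mulr0.
rewrite /pairing [RHS]big_mkcond; apply: eq_bigr => j _.
rewrite row_symE mulr_sumr.
rewrite (reindex_inj invg_inj) /=.
under eq_bigr => p _ do rewrite ffunE (can2_eq (@permuteVK _ p) (@permuteK _ p)).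
case: eqP => [/eRV[p0 p0R ->]|ne]; last first.
  apply: big1 => p; rewrite row_stabV => pR; case: eqP => [E|]; last by rewrite mulr0.
  by case: ne; rewrite E; apply: eR.
rewrite -mulr_sumr mulrC; congr (_ * _).
rewrite -natr_sum; congr _%:R.
rewrite (reindex_inj (mulgI p0)) -sum1_card [RHS]big_mkcond [LHS]big_mkcond /=.
apply: eq_bigr => p _; rewrite row_stabV row_stabMl // -permuteM.
rewrite [p \in [set _ in _ | _]]finset.in_set.
by rewrite (inj_eq (can_inj (@permuteK _ p0))) eq_sym; case: (p \in R); case: eqP.
Qed.

(** The dual form of [pairing_row_sym]: the vectors [tpow g e_row] span the image of [row_sym]. *)
Lemma row_sym_mem (U : {vspace T}) (x : T) :
  (forall g, tpow g e_row \in U) -> row_sym x \in U.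
Proof.
move=> UP; apply: mem_pairing => c cU; apply: pairing_row_sym => g.
exact: cU.
Qed.

Lemma card_box_row (i : 'I_n) : #|[set b : 'I_n | row b == i]| = nth 0%N eta i.
Proof.
pose h (c : 'I_(nth 0%N eta i)) : 'I_n := Ordinal (flatten_indexP (ltn_ord c)).
have h_inj : injective h.
  move=> c d /(congr1 (fun b : 'I_n => col b)); rewrite /box_col /= !flatten_indexKr //.
  exact: val_inj.
rewrite -[RHS]card_ord -(card_imset _ h_inj); apply: eq_card => b; rewrite inE.
apply/eqP/imsetP => [rE|[c _ ->]]; last exact: flatten_indexKl.
have cL : (col b < nth 0 eta i)%N by rewrite -rE; apply: reshape_offsetP.
by exists (Ordinal cL) => //; apply: val_inj; rewrite /= -rE reshape_indexK.
Qed.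

Lemma prod_row_filling (f : 'I_n -> F) :
  \prod_k f (row_filling k) = \prod_i f i ^+ nth 0%N eta i.
Proof.
rewrite (partition_big row_filling xpredT) //=; apply: eq_bigr => i _.
rewrite -card_box_row -prodr_const; apply: eq_big => [k|k /eqP->//].
by rewrite inE ffunE -val_eqE.
Qed.

End RowFilling.

(** * Highest weight vectors *)

Section HermitianForm.
Variables (F : numClosedFieldType) (n : nat).
Local Notation T := (tensor F n).
Implicit Types (x y z : T).

Definition dotT x y : F := \sum_j x j * (y j)^*.

Lemma dotTC x y : dotT y x = (dotT x y)^*.
Proof.
rewrite /dotT rmorph_sum; apply: eq_bigr => j _.
by rewrite rmorphM /= conjCK mulrC.
Qed.

Lemma dotT_pairing x y : dotT x y = pairing (fun j => (y j)^*) x.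
Proof. by apply: eq_bigr => j _; rewrite mulrC. Qed.

Lemma dotTZl a x y : dotT (a *: x) y = a * dotT x y.
Proof. by rewrite mulr_sumr; apply: eq_bigr => j _; rewrite ffunE [RHS]mulrA. Qed.

Lemma dotTZr a x y : dotT x (a *: y) = a^* * dotT x y.
Proof. by rewrite dotTC dotTZl rmorphM /= -dotTC. Qed.

Lemma dotT_eq0 x : (dotT x x == 0) = (x == 0).
Proof.
apply/eqP/eqP => [|->]; last by rewrite /dotT big1 // => j _; rewrite ffunE mul0r.
move/psumr_eq0P => H; apply/ffunP => j; apply/eqP; rewrite ffunE -normr_eq0.
rewrite -[_ == 0](@expf_eq0 _ _ 2) normCK; apply/eqP/H => // i _.
by rewrite -normCK exprn_ge0.
Qed.

Lemma dotT_kernel_op K x y :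
  dotT (kernel_op K x) y = dotT x (kernel_op (fun j i => (K i j)^*) y).
Proof.
rewrite /dotT; under eq_bigr do rewrite kernel_opE mulr_suml.
rewrite exchange_big /=; apply: eq_bigr => i _.
rewrite kernel_opE rmorph_sum mulr_sumr; apply: eq_bigr => j _.
by rewrite rmorphM /= conjCK -mulrA mulrCA.
Qed.

Lemma dotT_tpow A x y : dotT (tpow A x) y = dotT x (tpow (A^t*) y).
Proof.
rewrite dotT_kernel_op; congr (dotT _ _); apply/ffunP => j.
rewrite tpowE kernel_opE; apply: eq_bigr => i _; congr (_ * _).
by rewrite rmorph_prod; apply: eq_bigr => k _; rewrite !mxE.
Qed.

(** Taking adjoints inverts [s] and conjugates its coefficient, so the hypothesis makes the operator
    self-adjoint. *)
Lemma dotT_group_op c x y : (forall s, (c s)^* = c s^-1%g) ->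
  dotT (group_op c x) y = dotT x (group_op c y).
Proof.
move=> cV; rewrite dotT_kernel_op; congr (dotT _ _); apply/ffunP => j.
rewrite !kernel_opE; apply: eq_bigr => i _; congr (_ * _).
rewrite rmorph_sum (reindex_inj invg_inj) /=; apply: eq_bigr => s _.
rewrite rmorphM /= conjC_nat cV invgK; congr (_ * _%:R).
by rewrite (can2_eq (@permuteVK _ s) (@permuteK _ s)) eq_sym.
Qed.

(** Presents a difference of hermitian products as a functional of [x], the form to which
    [pairing_row_sym] applies. *)
Lemma dotT_pairing_diff (L K : 'End(T)) y z a b : exists c, forall x,
  dotT (L x) y * a - dotT (K x) z * b = pairing c x.
Proof.
exists (fun l => dotT (L (tensor_basis F l)) y * a - dotT (K (tensor_basis F l)) z * b).
have E (M : 'End(T)) v x : dotT (M x) v = \sum_l x l * dotT (M (tensor_basis F l)) v.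
  rewrite {1}[x]tensor_sum linear_sum dotT_pairing.
  under eq_bigr do rewrite linearZ.
  by rewrite pairing_sum; apply: eq_bigr => l _; rewrite dotT_pairing.
move=> x; rewrite !E !mulr_suml -sumrB; apply: eq_bigr => l _.
by rewrite -!mulrA -mulrBr mulrC.
Qed.

End HermitianForm.

(* Over the ring of polynomials, one step of Gaussian elimination replaces
   [[a, r], [c, B]] by [a B - c r], which keeps the value [1] at 0. *)
Lemma LU_generic (F : fieldType) m (G : 'M[{poly F}]_m) :
  map_mx (horner_eval 0) G = 1%:M ->
  exists2 q : {poly F}, q != 0 & forall t, q.[t] != 0 ->
    exists l u : 'M[F]_m, [/\ map_mx (horner_eval t) G = l *m u,
      is_trig_mx l, is_trig_mx u^T, l \in unitmx & u \in unitmx].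
Proof.
elim: m G => [|m IH] G G0.
  exists 1; rewrite ?oner_neq0 // => t _; exists 1%:M, 1%:M.
  split; rewrite ?unitmx1 ?trmx1 //; try by apply/is_trig_mxP => -[].
  by apply/matrixP => -[].
move: G G0; rewrite -[m.+1]/(1 + m)%N => G G0.
set a := G 0 0; set r := ursubmx G; set c := dlsubmx G; set B := drsubmx G.
have GE : G = block_mx a%:M r c B.
  by rewrite -[LHS]submxK; congr block_mx; apply/matrixP => i j; rewrite !ord1 !mxE !lshift0.
have a0 : a.[0] = 1.
  by have /matrixP/(_ 0 0) := G0; rewrite !mxE.
pose G' := a *: B - c *m r.
have G'0 : map_mx (horner_eval 0) G' = 1%:M.
  rewrite map_mxB map_mxM map_mxZ /= /horner_eval a0 scale1r.
  move: G0; rewrite GE map_block_mx scalar_mx_block => /eq_block_mx[_ r0 _ ->].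
  by rewrite r0 mulmx0 subr0.
have [q q0 qP] := IH G' G'0.
exists (a * q) => [|t].
  rewrite mulf_neq0 //; apply: contraTneq (oner_neq0 F) => E.
  by rewrite -a0 E horner0 eqxx.
rewrite hornerM mulf_eq0 negb_or => /andP[at0 /qP[l [u [luE lT uT lU uU]]]].
pose r' := map_mx (horner_eval t) r; pose c' := map_mx (horner_eval t) c.
pose B' := map_mx (horner_eval t) B.
exists (block_mx 1%:M 0 (a.[t]^-1 *: c') l).
exists (block_mx a.[t]%:M r' 0 (a.[t]^-1 *: u)); split.
- rewrite mulmx_block GE map_block_mx map_scalar_mx /= /horner_eval.
  rewrite !mul1mx !mul0mx !mulmx0 !addr0; congr block_mx.
    by rewrite mul_mx_scalar scalerA mulfV // scale1r.
  rewrite -scalemxAl -scalemxAr -luE map_mxB map_mxM map_mxZ /= /horner_eval.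
  by rewrite scalerBr scalerA mulVf // scale1r addrC subrK.
- by rewrite is_trig_block_mx // eqxx lT scalar_mx_is_trig.
- rewrite tr_block_mx is_trig_block_mx // trmx0 eqxx tr_scalar_mx scalar_mx_is_trig /=.
  apply/is_trig_mxP => i j ij; rewrite !mxE; have /is_trig_mxP/(_ i j ij) := uT.
  by rewrite mxE => ->; rewrite mulr0.
- by rewrite unitmxE det_lblock det1 mul1r -unitmxE.
- by rewrite unitmxE det_ublock det_scalar1 unitrMl -?unitmxE ?unitmxZ ?unitfE ?invr_eq0.
Qed.

(** * The operator attached to a highest weight vector *)

Section HighestWeight.
Variables (F : numClosedFieldType) (eta : seq nat).
Hypothesis eta_sorted : sorted geq eta.
Hypothesis eta_pos : 0%N \notin eta.
Local Notation n := (sumn eta).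
Local Notation row := (box_row eta).
Local Notation col := (box_col eta).
Local Notation R := (row_stab n eta).
Local Notation C := (col_stab n eta).
Local Notation T := (tensor F n).
Local Notation row_sym := (row_sym F eta).
Local Notation col_alt := (col_alt F eta).
Local Notation row_filling := (row_filling eta_pos).
Local Notation e_row := (tensor_basis F row_filling).
Local Notation "P @ t" := (map_mx (horner_eval t) P).
Implicit Types (x y z w : T) (j : multi_index n).

Definition highest_weight_vector w :=
  forall b : 'M[F]_n, b \in unitmx -> (forall i j : 'I_n, (j < i)%N -> b i j = 0) ->
    tpow b w = (\prod_i b i i ^+ nth 0%N eta i) *: w.

(** In [tpow b e_row] only indices [j] with [j k <= row k] for all [k] survive, as [b] is upper
    triangular. Such a [j] other than [row_filling] repeats an entry in some column, so its
    alternation is 0. *)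
Lemma col_alt_row_filling_hwv : highest_weight_vector (col_alt e_row).
Proof.
move=> b _ bT; rewrite -(prod_row_filling eta_pos (fun i => b i i)).
have -> : tpow b (col_alt e_row) = col_alt (tpow b e_row) by rewrite -group_op_tpow.
rewrite [tpow b e_row]tensor_sum linear_sum (bigD1 row_filling) //=.
rewrite linearZ /= tpow_row_filling [X in _ + X]big1 ?addr0 // => j jr; rewrite linearZ /=.
have [/existsP[k kj]|] := boolP [exists k : 'I_n, row k < j k]%N.
  rewrite tpow_row_filling (bigD1 k) //= bT ?mul0r ?scale0r //.
  by rewrite ffunE.
rewrite negb_exists => /forallP le.
suff [b0 [c0 [bc cE jE]]] : exists b c : 'I_n, [/\ b != c, col b = col c & j b = j c].
  by rewrite [X in _ *: X](col_alt_basis_eq0 F bc cE jE) scaler0.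
have [k kr] : exists k, j k != row_filling k.
  by apply/existsP; apply: contraNT jr; rewrite negb_exists => /forallP H;
     apply/eqP/ffunP => k; apply/eqP; have := H k; rewrite negbK.
(* From a box [k] with [j k < row k], go up its column to the box [d] in row [j k]: either
   [j d = j k], or [d] is a higher box where [j] differs from [row_filling]. *)
elim: {k}(row k) {-2}k (leqnn (row k)) kr => [|m IH] k km kr.
  case/eqP: kr; apply: val_inj; rewrite ffunE /=.
  by have := le k; rewrite -leqNgt; move: km; rewrite leqn0 => /eqP->; rewrite leqn0 => /eqP.
have jk : (j k < row k)%N.
  rewrite ltn_neqAle leqNgt le andbT; apply: contraNneq kr => E.
  by apply/eqP/val_inj; rewrite ffunE.
have [d dr dc] : exists2 d : 'I_n, row d = j k & col d = col k.
  by apply: (box_ex eta_sorted (b := k)) => //; apply: ltnW.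
have [jd|] := eqVneq (j d) (row_filling d).
  exists d, k; split=> //; last by rewrite jd; apply: val_inj; rewrite ffunE.
  by apply/eqP => dk; move: jk; rewrite -dr dk ltnn.
by apply: IH; rewrite dr -ltnS (leq_trans jk).
Qed.

(** A permutation preserving both rows and columns is trivial, so the coordinate at [row_filling] is
    1. *)
Lemma col_alt_row_filling_neq0 : col_alt e_row != 0.
Proof.
apply/eqP => /ffunP/(_ row_filling); rewrite col_altE ffunE (bigD1 1%g) ?col_stab1 //=.
rewrite odd_perm1 mul1r permute1 ffunE eqxx big1 => [|q /andP[/col_stabP qC q1]].
  by rewrite addr0 => /eqP; rewrite oner_eq0.
rewrite ffunE row_filling_stab; case: row_stabP => [qR|]; last by rewrite mulr0.
by case/eqP: q1; apply/permP => b; rewrite perm1; apply: box_inj.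
Qed.

(** [u] scales [w] on the left, and [l] moves to the right as its adjoint, which is upper triangular
    too. *)
Lemma hwv_LU w l u : highest_weight_vector w ->
  is_trig_mx l -> is_trig_mx u^T -> l \in unitmx -> u \in unitmx ->
  dotT (tpow (l *m u) w) w =
  (\prod_i u i i ^+ nth 0%N eta i) * (\prod_i l i i ^+ nth 0%N eta i) * dotT w w.
Proof.
move=> hw /is_trig_mxP lT /is_trig_mxP uT lU uU.
have uT' (i j : 'I_n) : (j < i)%N -> u i j = 0.
  by move=> ij; have := uT j i ij; rewrite mxE.
have lU' : l^t* \in unitmx by rewrite map_unitmx unitmx_tr.
have lT' (i j : 'I_n) : (j < i)%N -> (l^t*) i j = 0.
  by move=> ij; rewrite !mxE lT // rmorph0.
rewrite tpowM dotT_tpow (hw _ uU uT') (hw _ lU' lT').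
rewrite dotTZl dotTZr mulrA; congr (_ * _ * _).
rewrite rmorph_prod; apply: eq_bigr => i _.
by rewrite rmorphXn !mxE /= conjCK.
Qed.

(* [dotT (tpow g w) w] is determined by its value at [1] on the products
   [l *m u], and these are dense. *)
Lemma hwv_matrix_coef w w' g : highest_weight_vector w -> highest_weight_vector w' ->
  dotT (tpow g w) w * dotT w' w' = dotT (tpow g w') w' * dotT w w.
Proof.
move=> hw hw'; pose G : 'M[{poly F}]_n := 1%:M + 'X *: map_mx polyC (g - 1%:M).
have GE t : G @ t = 1%:M + t *: (g - 1%:M).
  by apply/matrixP => i j; rewrite !mxE /horner_eval !hornerE; case: eqP => _; rewrite /= ?mulr1n ?mulr0n hornerE.
have [|q q0 qP] := @LU_generic _ _ G; first by rewrite GE scale0r addr0.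
have [p pE] := tpow_poly (fun j => (w j)^*) w G.
have [p' pE'] := tpow_poly (fun j => (w' j)^*) w' G.
have p0 : dotT w' w' *: p - dotT w w *: p' = 0.
  apply: (poly_nat_eq0 q0) => k /qP[l [u [luE lT uT lU uU]]].
  rewrite !hornerE pE pE' -!dotT_pairing luE !hwv_LU //; ring.
have := congr1 (horner_eval 1) p0; rewrite /horner_eval !hornerE pE pE' -!dotT_pairing.
have -> : G @ 1 = g by rewrite GE scale1r addrC subrK.
move/eqP; rewrite subr_eq0 => /eqP.
by rewrite mulrC [RHS]mulrC.
Qed.

Lemma hwv_support w j : highest_weight_vector w -> w j != 0 ->
  exists p : 'S_n, j = permute row_filling p.
Proof.
(* A single diagonal matrix separates the weights: its eigenvalue on a basis tensor is 2 to the
   power [code_weight], which determines the index up to permutation. *)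
move=> hw wj; pose d := \row_(i < n) (2%:R ^+ (n.+1 ^ enum_rank i) : F).
have dU : diag_mx d \in unitmx.
  rewrite unitmxE det_diag unitfE; apply/prodf_neq0 => i _.
  by rewrite mxE expf_neq0 // pnatr_eq0.
have := hw _ dU; rewrite -(prod_row_filling eta_pos (fun i => diag_mx d i i)).
have dT (i k : 'I_n) : (k < i)%N -> diag_mx d i k = 0.
  by move=> ki; rewrite mxE -val_eqE gtn_eqF.
move=> /(_ dT) /ffunP/(_ j); rewrite tpow_diag ffunE => /(mulIf wj).
have E (f : 'I_n -> 'I_n) : \prod_k d 0 (f k) = 2%:R ^+ code_weight f.
  by rewrite /code_weight expr_sum; apply: eq_bigr => k _; rewrite mxE.
rewrite E; under [RHS]eq_bigr do rewrite mxE eqxx mulr1n; rewrite E.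
have two1 : 2%:R != 1 :> F by rewrite pnatr_eq1.
move/(ieexprIn (ltr0Sn _ 1) two1)/code_weight_perm => [p pE].
by exists p; apply/ffunP => k; rewrite pE [RHS]ffunE.
Qed.

(** Each rearrangement of [row_filling] comes from [#|R|] permutations, which the division
    compensates. *)
Definition hwv_coef w (s : 'S_n) : F := w (permute row_filling s^-1) / #|R|%:R.

Lemma card_row_stab_neq0 : #|R|%:R != 0 :> F.
Proof. by rewrite pnatr_eq0 -lt0n; apply/card_gt0P; exists 1%g; apply: row_stab1. Qed.

Lemma group_op_hwv_coef w : highest_weight_vector w ->
  group_op (hwv_coef w) e_row = w.
Proof.
move=> hw; apply/ffunP => j; rewrite group_opE.
transitivity (\sum_s (w j / #|R|%:R) * (permute j s == row_filling)%:R).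
  apply: eq_bigr => s _; rewrite ffunE; case: eqP => [E|]; last by rewrite !mulr0.
  by rewrite !mulr1 /hwv_coef -E permuteK.
rewrite -mulr_sumr; have [->|wj] := eqVneq (w j) 0; first by rewrite !mul0r.
have [p jE] := hwv_support hw wj.
suff -> : \sum_s (permute j s == row_filling)%:R = #|R|%:R :> F.
  by rewrite divfK // card_row_stab_neq0.
rewrite -natr_sum; congr _%:R.
rewrite (reindex_inj (mulIg p^-1%g)) /= -sum1_card [RHS]big_mkcond /=.
apply: eq_bigr => s _; rewrite jE permuteM mulgKV row_filling_stab.
by case: (s \in R).
Qed.

Definition hwv_op w : 'End(T) := (group_op (hwv_coef w) \o row_sym)%VF.

Lemma hwv_op_tpow w A x : hwv_op w (tpow A x) = tpow A (hwv_op w x).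
Proof. by rewrite !comp_lfunE /= !group_op_tpow. Qed.

(** On vectors [tpow g e_row] this is the proportionality of matrix coefficients, after moving both
    matrices to one side. Polarization extends it to the image of [row_sym], in one variable and
    then, by hermitian symmetry, in the other. *)
Lemma hwv_gram w x y : highest_weight_vector w ->
  dotT (hwv_op w x) (hwv_op w y) * dotT (col_alt e_row) (col_alt e_row) =
  dotT (col_alt (row_sym x)) (col_alt (row_sym y)) * dotT w w.
Proof.
move=> hw; have hw0 := col_alt_row_filling_hwv.
set w0 := col_alt e_row in hw0 *.
pose D x y := dotT (group_op (hwv_coef w) x) (group_op (hwv_coef w) y) * dotT w0 w0 -
  dotT (col_alt x) (col_alt y) * dotT w w.
have DC x' y' : D y' x' = (D x' y')^*.
  by rewrite /D rmorphB !rmorphM /= -!dotTC.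
have Dtp g h : D (tpow g e_row) (tpow h e_row) = 0.
  rewrite /D !group_op_tpow group_op_hwv_coef // -/w0.
  apply/eqP; rewrite subr_eq0; apply/eqP.
  have adj v : dotT (tpow g v) (tpow h v) = dotT (tpow (h^t* *m g) v) v.
    rewrite [in RHS]tpowM [RHS]dotT_tpow; congr (dotT _ (tpow _ _)).
    by rewrite map_trmx trmxK -map_mx_comp map_mx_id // => a /=; rewrite conjCK.
  by rewrite !adj (hwv_matrix_coef _ hw hw0).
have Drow x' h : D (row_sym x') (tpow h e_row) = 0.
  have [c cE] := dotT_pairing_diff (group_op (hwv_coef w)) col_alt
    (group_op (hwv_coef w) (tpow h e_row)) (col_alt (tpow h e_row)) (dotT w0 w0) (dotT w w).
  rewrite /D cE; apply: pairing_row_sym => g; rewrite -cE; exact: Dtp.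
apply/eqP; rewrite -subr_eq0 !comp_lfunE /= -/(D _ _); apply/eqP.
have [c cE] := dotT_pairing_diff (group_op (hwv_coef w)) col_alt
    (group_op (hwv_coef w) (row_sym x)) (col_alt (row_sym x)) (dotT w0 w0) (dotT w w).
rewrite DC; apply/eqP; rewrite conjC_eq0; apply/eqP.
rewrite /D cE; apply: pairing_row_sym => g; rewrite -cE.
by apply/eqP; rewrite -conjC_eq0 -/(D _ _) -DC Drow.
Qed.

(** Proportional Gram forms with nonzero factors vanish on the same vectors, and the hermitian form
    is definite. *)
Lemma lker_hwv_op w : highest_weight_vector w -> w != 0 ->
  lker (hwv_op w) = lker (col_alt \o row_sym)%VF.
Proof.
move=> hw w0; apply/vspaceP => x; rewrite !memv_ker -[LHS]dotT_eq0 -[RHS]dotT_eq0.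
rewrite [(col_alt \o row_sym)%VF x]comp_lfunE; have E := hwv_gram x x hw.
apply/eqP/eqP => H; apply/eqP.
  have /eqP : dotT (col_alt (row_sym x)) (col_alt (row_sym x)) * dotT w w = 0.
    by rewrite -E H mul0r.
  by rewrite mulf_eq0 [dotT w w == 0]dotT_eq0 (negPf w0) orbF.
have /eqP : dotT (hwv_op w x) (hwv_op w x) * dotT (col_alt e_row) (col_alt e_row) = 0.
  by rewrite E H mul0r.
by rewrite mulf_eq0 [dotT (col_alt e_row) _ == 0]dotT_eq0 (negPf col_alt_row_filling_neq0) orbF.
Qed.

Lemma dotT_row_sym x y : dotT (row_sym x) y = dotT x (row_sym y).
Proof. by apply: dotT_group_op => s; rewrite conjC_nat row_stabV. Qed.

Lemma dotT_col_alt x y : dotT (col_alt x) y = dotT x (col_alt y).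
Proof.
by apply: dotT_group_op => s; rewrite rmorphM /= conjC_nat rmorph_sign col_stabV odd_permV.
Qed.

(** [young_op F eta] is the adjoint of [col_alt \o row_sym], and composing an operator with its
    adjoint does not enlarge the kernel. *)
Lemma lker_young_sq :
  lker (young_op F eta \o (col_alt \o row_sym))%VF = lker (col_alt \o row_sym)%VF.
Proof.
apply/vspaceP => x; rewrite !memv_ker !comp_lfunE; apply/eqP/eqP => [E|->]; last by rewrite !linear0.
apply/eqP; rewrite -dotT_eq0 dotT_col_alt dotT_row_sym E.
by rewrite dotTC /dotT big1 ?rmorph0 // => j _; rewrite ffunE mul0r.
Qed.

(** A rank count. Let [K] be [col_alt \o row_sym] and [L] its adjoint: [L K] has the rank of [K] and
    [K L] that of [L], while the image of [K L] lies in that of [K]. *)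
Lemma limg_young_sq :
  limg (young_op F eta \o (col_alt \o row_sym))%VF = limg (young_op F eta).
Proof.
have dimE (K : 'End(T)) : (\dim (lker K) + \dim (limg K) = \dim {:T})%N.
  by rewrite -{1}[lker K]capfv limg_ker_dim.
apply/eqP; rewrite eqEdim limg_comp limgS ?subvf //=.
have E1 := dimE (young_op F eta \o (col_alt \o row_sym))%VF.
have E2 := dimE (col_alt \o row_sym)%VF.
have E3 := dimE (young_op F eta).
have E4 := dimE ((col_alt \o row_sym) \o young_op F eta)%VF.
have lk : lker ((col_alt \o row_sym) \o young_op F eta)%VF = lker (young_op F eta).
  apply/vspaceP => x; rewrite !memv_ker !comp_lfunE; apply/eqP/eqP => [E|->]; last by rewrite !linear0.
  apply/eqP; rewrite -dotT_eq0 dotT_row_sym dotT_col_alt E.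
  by rewrite dotTC /dotT big1 ?rmorph0 // => j _; rewrite ffunE mul0r.
rewrite lker_young_sq limg_comp in E1; rewrite lk limg_comp in E4.
have := dimvS (limgS (col_alt \o row_sym)%VF (subvf (limg (young_op F eta)))).
move=> le; rewrite -(leq_add2l (\dim (lker (col_alt \o row_sym)%VF))) E1.
rewrite -[X in (_ <= X)%N]E2 leq_add2l; apply: leq_trans le.
by rewrite -(leq_add2l (\dim (lker (young_op F eta)))) E3 E4.
Qed.

(* Both images are the quotient of the tensor space by the same kernel. *)
Lemma trace_hwv_op w (f : 'End(T)) : highest_weight_vector w -> w != 0 ->
  (forall c x, f (group_op c x) = group_op c (f x)) ->
  trace_on (limg (hwv_op w)) f = trace_on (limg (young_op F eta)) f.
Proof.
move=> hw w0 fc; rewrite -limg_young_sq; apply: trace_on_limg.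
- by rewrite lker_young_sq lker_hwv_op.
- by move=> x; rewrite !comp_lfunE /= !fc.
- by move=> x; rewrite !comp_lfunE /= !fc.
Qed.

End HighestWeight.

(** * The Specht module as a zero weight space *)

Lemma dim_span_rows (F : fieldType) (V : vectType F) m N (W : 'M[F]_(m, N))
    (psi : {linear 'rV[F]_N -> V}) : injective psi ->
  \dim <<[seq psi (row i W) | i <- enum 'I_m]>> = \rank W.
Proof.
move=> psi_inj; pose B := row_base W.
pose Y := [tuple psi (row i B) | i < \rank W].
have psiB m1 (M : 'M[F]_(m1, N)) (k : 'rV[F]_m1) :
    psi (k *m M) = \sum_i k 0 i *: psi (row i M).
  by rewrite mulmx_sum_row linear_sum; apply: eq_bigr => i _; rewrite linearZ.
have Yi (i : 'I_(\rank W)) : Y`_i = psi (row i B) by rewrite -tnth_nth tnth_mktuple.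
have freeY : free Y.
  apply/freeP => k k0 i; have kB : (\row_i k i) *m B = 0.
    apply: psi_inj; rewrite linear0 psiB -[RHS]k0; apply: eq_bigr => l _.
    by rewrite mxE Yi.
  have : (\row_i k i) = 0 by apply: (row_free_inj (row_base_free W)); rewrite mul0mx.
  by move/rowP/(_ i); rewrite !mxE.
have -> : <<[seq psi (row i W) | i <- enum 'I_m]>>%VS = <<Y>>%VS; last first.
  by rewrite (eqP freeY) size_tuple.
apply/eqP; rewrite eqEsubv; apply/andP; split; apply/span_subvP => _ /mapP[i _ ->].
  have /submxP[D ->] : (row i W <= B)%MS by rewrite eq_row_base row_sub.
  rewrite psiB; apply: memv_suml => k _; apply/memvZ/memv_span.
  by rewrite -Yi mem_nth // size_tuple.
have /submxP[D ->] : (row i B <= W)%MS by rewrite -(eq_row_base W) row_sub.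
rewrite psiB; apply: memv_suml => k _; apply/memvZ/memv_span.
by apply: map_f; rewrite mem_enum.
Qed.

Section SpechtDimension.
Variables (F : numClosedFieldType) (eta : seq nat).
Local Notation n := (sumn eta).
Local Notation R := (row_stab n eta).
Local Notation C := (col_stab n eta).
Local Notation T := (tensor F n).
Local Notation row_sym := (row_sym F eta).
Local Notation col_alt := (col_alt F eta).
Local Notation G := [set: 'S_n]%G.
Local Notation T0 := (zero_weight_space F n).

Definition perm_tensor (v : 'rV[F]_#|G|) : T :=
  \sum_i v 0 i *: tensor_basis F (finfun (enum_val i : 'S_n)).

Fact perm_tensor_is_linear : linear perm_tensor.
Proof.
move=> a u v; rewrite /perm_tensor scaler_sumr -big_split /=; apply: eq_bigr => i _.
by rewrite !mxE scalerDl scalerA.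
Qed.

HB.instance Definition _ :=
  GRing.isLinear.Build F 'rV[F]_#|G| T _ perm_tensor perm_tensor_is_linear.

Lemma finfun_perm_inj : injective (fun s : 'S_n => finfun s : multi_index n).
Proof.
by move=> s s' /ffunP E; apply/permP => b; have := E b; rewrite !ffunE.
Qed.

Lemma perm_tensor_inj : injective perm_tensor.
Proof.
move=> u v /ffunP E; apply/rowP => i.
suff H (w : 'rV[F]_#|G|) : perm_tensor w (finfun (enum_val i : 'S_n)) = w 0 i by rewrite -!H E.
rewrite /perm_tensor sum_ffunE (bigD1 i) //= big1 => [|k ki].
  by rewrite addr0 !ffunE eqxx [LHS]mulr1.
rewrite !ffunE (inj_eq finfun_perm_inj) (inj_eq enum_val_inj) eq_sym (negPf ki).
exact: mulr0.
Qed.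

Lemma perm_tensor_delta (s : 'S_n) :
  perm_tensor (delta_mx 0 (gring_index G s)) = tensor_basis F (finfun s).
Proof.
rewrite /perm_tensor (bigD1 (gring_index G s)) //= big1 => [|k ki].
  by rewrite mxE !eqxx scale1r addr0 gring_indexK ?inE.
by rewrite mxE (negPf ki) andbF scale0r.
Qed.

Lemma permute_finfun (s p : 'S_n) : permute (finfun s) p = finfun (p * s)%g :> multi_index n.
Proof. by apply/ffunP => b; rewrite !ffunE permM. Qed.

(** The inverses created by pulling back coordinates disappear on summation, because [R], [C] and
    the sign are invariant under inversion. *)
Lemma perm_tensor_young (s : 'S_n) :
  perm_tensor (young_symmetrizer F n eta *m regular_rep F n s) =
  col_alt (row_sym (tensor_basis F (finfun s))).
Proof.
have deltaM (g : 'S_n) : delta_mx 0 (gring_index G g) *m regular_rep F n s =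
    delta_mx 0 (gring_index G (g * s)%g) :> 'rV[F]_#|G|.
  by rewrite -rowE rowK gring_indexK ?inE.
have -> : perm_tensor (young_symmetrizer F n eta *m regular_rep F n s) =
    \sum_(p in R) \sum_(q in C) (-1) ^+ q *: tensor_basis F (finfun (q * p * s)%g).
  rewrite mulmx_suml linear_sum; apply: eq_bigr => p _.
  rewrite mulmx_suml linear_sum; apply: eq_bigr => q _.
  by rewrite -scalemxAl linearZ /= deltaM perm_tensor_delta.
rewrite exchange_big; apply/ffunP => j; rewrite col_altE sum_ffunE.
rewrite (reindex_inj invg_inj) /=; apply: eq_big => [q|q _]; first by rewrite col_stabV.
rewrite odd_permV row_symE mulr_sumr sum_ffunE (reindex_inj invg_inj) /=.
apply: eq_big => [p|p _]; first by rewrite row_stabV.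
rewrite !ffunE; congr (_ * _%:R); rewrite permuteM -mulgA -permute_finfun.
rewrite -permute_finfun permuteM -invMg.
by rewrite (can2_eq (@permuteK _ (p * q)) (@permuteVK _ (p * q))).
Qed.

Lemma dim_young_zero_weight :
  \dim ((col_alt \o row_sym)%VF @: T0) = \rank (specht_module F n eta).
Proof.
rewrite /specht_module /cyclic_mx mxrank_gen -(dim_span_rows _ perm_tensor_inj).
congr (\dim _); rewrite limg_span -map_comp; apply: eq_span => x.
(* The rows of the matrix behind [cyclic_mx] are the translates of the Young symmetrizer by the
   group elements. *)
have rowE (i : 'I_#|G|) : perm_tensor (row i (enveloping_algebra_mx (regular_rep F n) *m
      lin_mul_row (young_symmetrizer F n eta))) =
    (col_alt \o row_sym)%VF (tensor_basis F (finfun (enum_val i : 'S_n))).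
  rewrite comp_lfunE -perm_tensor_young; congr perm_tensor.
  by rewrite row_mul rowK mul_vec_lin_row.
apply/mapP/mapP => [[s _ ->]|[i _ ->]].
  exists (gring_index G s); first by rewrite mem_enum.
  by rewrite [RHS]rowE gring_indexK ?inE.
by exists (enum_val i); rewrite ?mem_enum // [LHS]rowE.
Qed.

(** The coordinate projection onto the zero weight space, since an injective map from ['I_n] to
    itself is a permutation. *)
Definition injective_part : 'End(T) :=
  kernel_op (fun j i => (injectiveb j && (i == j))%:R).

Lemma injective_partE (x : T) j : injective_part x j = (injectiveb j)%:R * x j.
Proof.
rewrite kernel_opE (bigD1 j) //= eqxx andbT big1 ?addr0 // => i /negPf ->.
by rewrite andbF mul0r.
Qed.

Lemma injective_part_id x : x \in T0 -> injective_part x = x.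
Proof.
suff /subvP H : (T0 <= fixedSpace injective_part)%VS by move/H/fixedSpaceP.
apply/span_subvP => _ /mapP[s _ ->]; apply/fixedSpaceP; apply/ffunP => j.
rewrite injective_partE ffunE; case: eqP => [->|]; last by rewrite mulr0.
suff -> : injectiveb (finfun s) by rewrite mul1r.
by apply/injectiveP => a b; rewrite !ffunE => /perm_inj.
Qed.

Lemma injective_part_mem x : injective_part x \in T0.
Proof.
rewrite [injective_part x]tensor_sum; apply: memv_suml => j _.
rewrite injective_partE; case: injectiveP => [j_inj|]; last by rewrite mul0r scale0r mem0v.
apply/memvZ/memv_span; apply/mapP; exists (perm j_inj); first by rewrite mem_enum.
by congr tensor_basis; apply/ffunP => b; rewrite ffunE permE.
Qed.

Lemma injective_part_group_op c x :
  injective_part (group_op c x) = group_op c (injective_part x).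
Proof.
apply/ffunP => j; rewrite injective_partE !group_opE mulr_sumr; apply: eq_bigr => s _.
rewrite injective_partE mulrCA; congr (_ * ((nat_of_bool _)%:R * _)).
apply/injectiveP/injectiveP => j_inj a b; first by rewrite !ffunE => /j_inj/perm_inj.
have := j_inj (s^-1 a)%g (s^-1 b)%g; rewrite !ffunE !permKV => H /H.
exact: perm_inj.
Qed.

Lemma limg_cap_zero_weight (L : 'End(T)) :
  (forall x, injective_part (L x) = L (injective_part x)) ->
  (limg L :&: T0 = L @: T0)%VS.
Proof.
move=> LC; apply/eqP; rewrite eqEsubv; apply/andP; split; apply/subvP => y.
  rewrite memv_cap => /andP[/memv_imgP[x _ ->] /injective_part_id <-].
  by rewrite LC memv_img // injective_part_mem.
case/memv_imgP => x /injective_part_id <- ->; rewrite memv_cap.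
by rewrite memv_img ?memvf // -LC injective_part_mem.
Qed.

End SpechtDimension.

(** Operators with equal kernels have images of [T0] of equal dimension, so [hwv_op] may be replaced
    by [col_alt \o row_sym]. *)
Theorem dim_hwv_zero_weight (F : numClosedFieldType) (eta : seq nat)
    (eta_sorted : sorted geq eta) (eta_pos : 0%N \notin eta) w :
  highest_weight_vector w -> w != 0 ->
  \dim (limg (hwv_op eta_pos w) :&: zero_weight_space F (sumn eta)) =
  \rank (specht_module F (sumn eta) eta).
Proof.
move=> hw w0; rewrite limg_cap_zero_weight; last first.
  by move=> x; rewrite !comp_lfunE !injective_part_group_op.
rewrite -dim_young_zero_weight; apply/eqP.
rewrite -(eqn_add2l (\dim (zero_weight_space F (sumn eta) :&: lker (hwv_op eta_pos w)))).
by rewrite limg_ker_dim lker_hwv_op // limg_ker_dim.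
Qed.

(** * From unitary matrices to all matrices *)

Lemma horner_const (F : fieldType) m n (A : 'M[F]_(m, n)) t :
  map_mx (horner_eval t) (map_mx polyC A) = A.
Proof. by apply/matrixP => i j; rewrite !mxE /horner_eval hornerC. Qed.

Lemma horner_line (F : fieldType) m n (A : 'M[F]_(m, n)) t :
  map_mx (horner_eval t) ('X *: map_mx polyC A) = t *: A.
Proof. by apply/matrixP => i j; rewrite !mxE /horner_eval hornerM hornerX hornerC. Qed.

Lemma adj_invmx (F : fieldType) n (M : 'M[F]_n) :
  M \in unitmx -> \adj M = \det M *: invmx M.
Proof. by move=> MU; rewrite /invmx MU scalerA mulfV ?scale1r // -unitfE -unitmxE. Qed.

Section UnitarianTrick.
Variables (F : numClosedFieldType) (n : nat).
Local Notation T := (tensor F n).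
Local Notation "P @ t" := (map_mx (horner_eval t) P).
Variable U : {vspace T}.
Hypothesis U_unitary :
  forall u : 'M[F]_n, u \is unitarymx -> {in U, forall x, tpow u x \in U}.
Implicit Types (x : T) (H A g : 'M[F]_n).

(** The two factors are adjoint to each other and commute. *)
Lemma cayley_unitary H : H^t* = H -> (1%:M - 'i *: H) \in unitmx ->
  (1%:M + 'i *: H) *m invmx (1%:M - 'i *: H) \is unitarymx.
Proof.
set M := 1%:M - _; set N := 1%:M + _ => HH MU.
have MN : M^t* = N.
  rewrite /M /N linearB /= map_mxB trmx1 map_mx1 linearZ /= map_mxZ HH /= conjCi.
  by rewrite scaleNr opprK.
have NM : N^t* = M.
  rewrite /M /N linearD /= map_mxD trmx1 map_mx1 linearZ /= map_mxZ HH /= conjCi.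
  by rewrite scaleNr.
have NU : N \in unitmx by rewrite -MN map_unitmx unitmx_tr.
have com : N *m M = M *m N.
  by rewrite /M mulmxBr mulmxBl mulmx1 mul1mx /N mulmxDl mulmxDr mul1mx mulmx1.
apply/unitarymxP; rewrite trmx_mul map_mxM NM trmx_inv map_invmx MN.
rewrite -mulmxA [invmx M *m _]mulmxA.
have -> : invmx M *m invmx N = invmx N *m invmx M.
  have inv2 (X Y : 'M[F]_n) : X \in unitmx -> Y \in unitmx -> invmx X *m invmx Y = invmx (Y *m X).
    move=> XU YU; have YXU : Y *m X \in unitmx by rewrite unitmx_mul YU.
    by rewrite -[LHS]mulmx1 -(mulmxV YXU) !mulmxA mulmxKV // mulVmx // mul1mx.
  by rewrite !inv2 // com.
by rewrite -mulmxA mulVmx // mulmx1 mulmxV.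
Qed.

(** The adjugate replaces the inverse to keep the transform polynomial; they differ by a
    determinant, which only rescales the tensor power. Along the line of multiples of [H] this
    determinant is 1 at 0, hence a nonzero polynomial. *)
Lemma cayley_hermitian_stable H x : H^t* = H -> x \in U ->
  tpow ((1%:M + 'i *: H) *m \adj (1%:M - 'i *: H)) x \in U.
Proof.
move=> HH xU; pose PH := 'X *: map_mx polyC ('i *: H).
pose P := (1%:M + PH) *m \adj (1%:M - PH).
have PHE t : PH @ t = 'i *: (t *: H).
  by rewrite horner_line !scalerA mulrC.
have ME t : (1%:M - PH) @ t = 1%:M - 'i *: (t *: H).
  by rewrite map_mxB map_mx1 PHE.
have PE t : P @ t = (1%:M + 'i *: (t *: H)) *m \adj (1%:M - 'i *: (t *: H)).
  by rewrite map_mxM map_mx_adj ME map_mxD map_mx1 PHE.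
have detE t : (\det (1%:M - PH)).[t] = \det (1%:M - 'i *: (t *: H)).
  by rewrite -ME det_map_mx.
suff : tpow (P @ 1) x \in U by rewrite PE scale1r.
apply: (@tpow_dense_mem _ _ _ _ _ (\det (1%:M - PH))).
  apply/eqP => E; have := detE 0; rewrite E horner0 scale0r scaler0 subr0 det1.
  by move/esym/eqP; rewrite oner_eq0.
move=> k; rewrite detE PE; set Hk := k%:R *: H => kU.
have HkH : Hk^t* = Hk by rewrite /Hk linearZ /= map_mxZ /= conjC_nat HH.
have MU : (1%:M - 'i *: Hk) \in unitmx by rewrite unitmxE unitfE.
by rewrite (adj_invmx MU) -scalemxAr tpowZ memvZ // U_unitary // cayley_unitary.
Qed.

(* [A = H + i K] with [H] and [K] hermitian, and [H + t K] is hermitian for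
   real [t]. *)
Lemma cayley_stable A x : x \in U ->
  tpow ((1%:M + 'i *: A) *m \adj (1%:M - 'i *: A)) x \in U.
Proof.
move=> xU; pose H := 2%:R^-1 *: (A + A^t*); pose K := - 'i / 2%:R *: (A - A^t*).
have two0 : 2%:R != 0 :> F by rewrite pnatr_eq0.
have AA : (A^t*)^t* = A by rewrite trmxCK.
have HH : H^t* = H.
  rewrite /H linearZ /= map_mxZ linearD /= map_mxD AA addrC /=; congr (_ *: _).
  by rewrite fmorphV rmorph_nat.
have KK : K^t* = K.
  rewrite /K linearZ /= map_mxZ linearB /= map_mxB AA /= -opprB scalerN -scaleNr; congr (_ *: _).
  by rewrite rmorphM rmorphN /= conjCi fmorphV rmorph_nat opprK mulNr.
have AE : A = H + 'i *: K.
  rewrite /H /K scalerA mulrA mulrN -expr2 sqrCi opprK mul1r -scalerDr.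
  by rewrite addrACA subrr addr0 -mulr2n -scaler_nat scalerA mulVf // scale1r.
pose PH := map_mx polyC ('i *: H) + 'X *: map_mx polyC ('i *: K).
pose P := (1%:M + PH) *m \adj (1%:M - PH).
have PHE t : PH @ t = 'i *: (H + t *: K).
  by rewrite map_mxD horner_line horner_const scalerDr !scalerA [t * _]mulrC.
have PE t : P @ t = (1%:M + 'i *: (H + t *: K)) *m \adj (1%:M - 'i *: (H + t *: K)).
  by rewrite map_mxM map_mx_adj map_mxB map_mxD map_mx1 PHE.
rewrite AE -PE; apply: (@tpow_dense_mem _ _ _ _ _ 1); first exact: oner_neq0.
move=> k _; rewrite PE; apply: cayley_hermitian_stable => //.
by rewrite linearD /= map_mxD HH linearZ /= map_mxZ KK /= conjC_nat.
Qed.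

(* Away from the eigenvalue [-1], the Cayley transform is invertible. *)
Lemma cayley_inv_stable g x : (1%:M + g) \in unitmx -> x \in U -> tpow g x \in U.
Proof.
move=> gU xU; pose A := - 'i *: ((g - 1%:M) *m invmx (1%:M + g)).
have iA : 'i *: A = (g - 1%:M) *m invmx (1%:M + g).
  by rewrite /A scalerA mulrN -expr2 sqrCi opprK scale1r.
have two0 : 2%:R != 0 :> F by rewrite pnatr_eq0.
have E1 : 1%:M = (1%:M + g) *m invmx (1%:M + g) by rewrite mulmxV.
have E2 : 1%:M + 'i *: A = 2%:R *: (g *m invmx (1%:M + g)).
  rewrite iA {1}E1 -mulmxDl addrC addrA subrK.
  by rewrite -mulr2n -scaler_nat scalemxAl.
have E3 : 1%:M - 'i *: A = 2%:R *: invmx (1%:M + g).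
  rewrite iA {1}E1 -mulmxBl opprB addrACA subrr addr0.
  by rewrite -mulr2n -scaler_nat -scalemxAl mul1mx.
have MU : (1%:M - 'i *: A) \in unitmx by rewrite E3 unitmxZ ?unitfE // unitmx_inv.
have dU : \det (1%:M - 'i *: A) != 0 by move: MU; rewrite unitmxE unitfE.
have := cayley_stable A xU.
rewrite (adj_invmx MU).
have -> : (1%:M + 'i *: A) *m (\det (1%:M - 'i *: A) *: invmx (1%:M - 'i *: A)) =
   \det (1%:M - 'i *: A) *: g.
  rewrite -scalemxAr; congr (_ *: _); rewrite E2 E3.
  have -> : invmx (2%:R *: invmx (1%:M + g)) = 2%:R^-1 *: (1%:M + g).
    by rewrite invmxZ -?E3 // invmxK.
  rewrite -scalemxAl -scalemxAr scalerA mulfV //.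
  by rewrite scale1r mulmxKV.
rewrite tpowZ => dx; rewrite -[tpow g x](scalerK (a := \det (1%:M - 'i *: A) ^+ n)).
  exact: memvZ.
exact: expf_neq0.
Qed.

(** [cayley_inv_stable] covers [t *: A] for all but finitely many [t]; density then gives
    [t = 1]. *)
Lemma unitary_stable_tpow A x : x \in U -> tpow A x \in U.
Proof.
move=> xU; pose P := 'X *: map_mx polyC A.
have PE t : P @ t = t *: A by rewrite horner_line.
have detE t : (\det (1%:M + P)).[t] = \det (1%:M + t *: A).
  by rewrite -PE -[in RHS](map_mx1 (horner_eval t)) -map_mxD det_map_mx.
rewrite -[A]scale1r -PE; apply: (@tpow_dense_mem _ _ _ _ _ (\det (1%:M + P))).
  apply/eqP => E; have := detE 0; rewrite E horner0 scale0r addr0 det1.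
  by move/esym/eqP; rewrite oner_eq0.
by move=> k; rewrite detE => kU; rewrite PE cayley_inv_stable // unitmxE unitfE.
Qed.

End UnitarianTrick.

(** * Haar integrals *)

Section UnitaryTopology.
Import numFieldNormedType.Exports.
Local Open Scope classical_set_scope.
Variables (R : realType) (n : nat).
Local Notation C := (R[i]^o).
Local Notation U := (unitary_group R n).
Local Notation B := (unitary_borel R n).

Lemma normc_ge_Im (z : R[i]) : (`|complex.Im z|%:C <= `|z|)%C.
Proof.
have -> : complex.Im z = - complex.Re ('i%C * z).
  by case: z => a b /=; rewrite mul0r mul1r sub0r opprK.
rewrite normrN; apply: le_trans (normc_ge_Re _) _.
rewrite normrM (_ : `|'i%C| = 1) ?mul1r // normc_def /= expr0n expr1n add0r sqrtr1.
by [].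
Qed.

Lemma open_Re_gt (x : R) : open [set z : C | x < complex.Re z].
Proof.
rewrite openE => z /= xz; apply/nbhs_ballP.
exists ((complex.Re z - x)%:C%C : R[i]); first by rewrite /= ltcR subr_gt0.
move=> z' /= zz'; have := le_lt_trans (normc_ge_Re (z - z')) zz'.
rewrite ltcR raddfB => /(le_lt_trans (ler_norm _)); rewrite ltrBlDr -ltrBlDl.
by rewrite opprB addrCA subrr addr0.
Qed.

Lemma open_Im_gt (x : R) : open [set z : C | x < complex.Im z].
Proof.
rewrite openE => z /= xz; apply/nbhs_ballP.
exists ((complex.Im z - x)%:C%C : R[i]); first by rewrite /= ltcR subr_gt0.
move=> z' /= zz'; have := le_lt_trans (normc_ge_Im (z - z')) zz'.
rewrite ltcR raddfB => /(le_lt_trans (ler_norm _)); rewrite ltrBlDr -ltrBlDl.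
by rewrite opprB addrCA subrr addr0.
Qed.

Lemma measurable_preimage_open (O : set 'M[C]_n) : open O ->
  measurable ((fun u : B => val u) @^-1` O).
Proof. by move=> oO; apply: sub_sigma_algebra; exists O. Qed.

Lemma measurable_entry_Re i j : measurable_fun setT (fun u : B => complex.Re (val u i j)).
Proof.
move=> mT; apply: (measurability _ (RGenOInfty.measurableE R)) => // _ [_ [x ->] <-].
rewrite setTI; have -> : (fun u : B => complex.Re (val u i j)) @^-1` `]x, +oo[ =
    (fun u : B => val u) @^-1` ((fun M : 'M[C]_n => M i j) @^-1` [set z | x < complex.Re z]).
  by apply/seteqP; split=> u /=; rewrite in_itv /= andbT.
apply: measurable_preimage_open; apply: open_comp; last exact: open_Re_gt.
by move=> M _; apply: coord_continuous.
Qed.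

Lemma measurable_entry_Im i j : measurable_fun setT (fun u : B => complex.Im (val u i j)).
Proof.
move=> mT; apply: (measurability _ (RGenOInfty.measurableE R)) => // _ [_ [x ->] <-].
rewrite setTI; have -> : (fun u : B => complex.Im (val u i j)) @^-1` `]x, +oo[ =
    (fun u : B => val u) @^-1` ((fun M : 'M[C]_n => M i j) @^-1` [set z | x < complex.Im z]).
  by apply/seteqP; split=> u /=; rewrite in_itv /= andbT.
apply: measurable_preimage_open; apply: open_comp; last exact: open_Im_gt.
by move=> M _; apply: coord_continuous.
Qed.

Lemma continuous_mulmxl (g : 'M[R[i]]_n) :
  continuous (fun M : 'M[C]_n => g *m M : 'M[C]_n).
Proof.
move=> M A [P MP PA]; rewrite nbhs_simpl /=.
have H i j : nbhs M (fun M' : 'M[C]_n => P i j ((g *m M') i j)).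
  have cont : (fun M' : 'M[C]_n => (g *m M') i j : C) @ M --> ((g *m M) i j : C).
    have sum_cont (r : seq 'I_n) : (fun M' : 'M[C]_n => \sum_(k <- r) g i k * M' k j : C) @ M
        --> (\sum_(k <- r) g i k * M k j : C).
      have FM : Filter (nbhs M) by apply: filter_filter.
      elim: r => [|k r IH].
        rewrite big_nil (_ : (fun M' : 'M[C]_n => _) = cst 0); first exact: cvg_cst.
        by apply/funext => M'; rewrite big_nil.
      rewrite big_cons (_ : (fun M' : 'M[C]_n => _) =
        (fun M' => g i k * M' k j) \+ (fun M' => \sum_(l <- r) g i l * M' l j)).
        by apply: cvgD IH; apply: cvgMl_tmp; apply: coord_continuous.
      by apply/funext => M'; rewrite big_cons.
    under eq_fun do rewrite mxE.
    by rewrite mxE; apply: sum_cont.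
  exact: (cont _ (MP i j)).
have FM : Filter (nbhs M) by apply: filter_filter.
have : nbhs M (fun M' : 'M[C]_n => forall i j, P i j ((g *m M') i j)).
  have H' i := filter_forall FM (H i).
  exact: (filter_forall FM H').
by apply: filterS => M' ?; apply: PA.
Qed.

Lemma measurable_unitary_mul (g : U) :
  measurable_fun setT (unitary_mul g : B -> B).
Proof.
have E : @measurable _ B = <<s @unitary_open R n >> by [].
have H := @measurability _ _ B B setT (unitary_mul g) (@unitary_open R n) E.
apply: H => _ [V [Q Qo VE] <-]; rewrite -{}VE.
rewrite setTI.
apply: (measurable_preimage_open (O := (fun M : 'M[C]_n => val g *m M : 'M[C]_n) @^-1` Q)).
apply: open_comp => // M _; apply: continuous_mulmxl.
Qed.

End UnitaryTopology.

(** * Integration of complex functions on the unitary group *)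

Section ComplexIntegral.
Import numFieldNormedType.Exports.
Local Open Scope classical_set_scope.
Variables (R : realType) (n : nat).
Local Notation U := (unitary_group R n).
Local Notation B := (unitary_borel R n).
Implicit Types (f g : B -> R) (h k : U -> R[i]).

(** A class closed under sums and products whose members are integrable for every probability
    measure. *)
Definition bounded_measurable f :=
  measurable_fun setT f /\ exists M, forall u, `|f u| <= M.

Lemma bounded_measurable_cst (a : R) : bounded_measurable (fun=> a).
Proof. by split; [exact: measurable_cst | exists `|a|]. Qed.

Lemma bounded_measurableD f g : bounded_measurable f -> bounded_measurable g ->
  bounded_measurable (fun u => f u + g u).
Proof.
move=> [mf [M fM]] [mg [N gN]]; split; first exact: measurable_funD.
by exists (M + N) => u; apply: le_trans (ler_normD _ _) (lerD _ _).
Qed.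

Lemma bounded_measurableM f g : bounded_measurable f -> bounded_measurable g ->
  bounded_measurable (fun u => f u * g u).
Proof.
move=> [mf [M fM]] [mg [N gN]]; split; first exact: measurable_funM.
by exists (M * N) => u; rewrite normrM ler_pM.
Qed.

Lemma bounded_measurableN f : bounded_measurable f ->
  bounded_measurable (fun u => - f u).
Proof.
move=> bf; rewrite (_ : (fun u => - f u) = fun u => (-1) * f u).
  by apply: bounded_measurableM => //; apply: bounded_measurable_cst.
by apply/funext => u; rewrite mulN1r.
Qed.

Definition cbounded_measurable h :=
  bounded_measurable (fun u => complex.Re (h u)) /\
  bounded_measurable (fun u => complex.Im (h u)).

Lemma cbounded_measurable_cst (a : R[i]) : cbounded_measurable (fun=> a).
Proof. by split; apply: bounded_measurable_cst. Qed.

Lemma ReM (x y : R[i]) :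
  complex.Re (x * y) = complex.Re x * complex.Re y - complex.Im x * complex.Im y.
Proof. by case: x y => [a b] [c d]. Qed.

Lemma ImM (x y : R[i]) :
  complex.Im (x * y) = complex.Re x * complex.Im y + complex.Im x * complex.Re y.
Proof. by case: x y => [a b] [c d]. Qed.

Lemma cbounded_measurableD h k : cbounded_measurable h -> cbounded_measurable k ->
  cbounded_measurable (fun u => h u + k u).
Proof.
move=> [Rh Ih] [Rk Ik]; split.
  under eq_fun do rewrite raddfD; exact: bounded_measurableD.
under eq_fun do rewrite raddfD; exact: bounded_measurableD.
Qed.

Lemma cbounded_measurableM h k : cbounded_measurable h -> cbounded_measurable k ->
  cbounded_measurable (fun u => h u * k u).
Proof.
move=> [Rh Ih] [Rk Ik]; split.
  under eq_fun do rewrite ReM; apply: bounded_measurableD; last apply: bounded_measurableN;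
    exact: bounded_measurableM.
by under eq_fun do rewrite ImM; apply: bounded_measurableD; exact: bounded_measurableM.
Qed.

Lemma cbounded_measurable_sum (I : Type) (r : seq I) (P : pred I) (F : I -> U -> R[i]) :
  (forall i, cbounded_measurable (F i)) ->
  cbounded_measurable (fun u => \sum_(i <- r | P i) F i u).
Proof.
move=> FP; elim: r => [|i r IH].
  by under eq_fun do rewrite big_nil; apply: cbounded_measurable_cst.
under eq_fun do rewrite big_cons; case: (P i) => //.
exact: cbounded_measurableD.
Qed.

Lemma cbounded_measurable_prod (I : Type) (r : seq I) (P : pred I) (F : I -> U -> R[i]) :
  (forall i, cbounded_measurable (F i)) ->
  cbounded_measurable (fun u => \prod_(i <- r | P i) F i u).
Proof.
move=> FP; elim: r => [|i r IH].
  by under eq_fun do rewrite big_nil; apply: cbounded_measurable_cst.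
under eq_fun do rewrite big_cons; case: (P i) => //.
exact: cbounded_measurableM.
Qed.

Lemma unitary_entry_le1 (u : U) i j : `|val u i j| <= 1.
Proof.
have /unitarymxP/matrixP/(_ i i) := valP u; rewrite !mxE eqxx => E.
rewrite -(@expr_le1 _ 2) // -[leRHS]/(true%:R) -E (bigD1 j) //= !mxE normCK lerDl.
by apply: sumr_ge0 => l _; rewrite !mxE -normCK exprn_ge0.
Qed.

Lemma cbounded_measurable_entry i j : cbounded_measurable (fun u => val u i j).
Proof.
split; split; [exact: measurable_entry_Re| exists 1 => u | exact: measurable_entry_Im | exists 1 => u].
  by rewrite -lecR; apply: le_trans (normc_ge_Re _) (unitary_entry_le1 _ _ _).
by rewrite -lecR; apply: le_trans (normc_ge_Im _) (unitary_entry_le1 _ _ _).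
Qed.

Lemma cbounded_measurable_conj h : cbounded_measurable h ->
  cbounded_measurable (fun u => (h u)^*).
Proof.
move=> [Rh Ih]; split.
  by rewrite (_ : (fun u => _) = fun u => complex.Re (h u)) //; apply/funext => u; case: (h u).
rewrite (_ : (fun u => _) = fun u => - complex.Im (h u)); first exact: bounded_measurableN.
by apply/funext => u; case: (h u).
Qed.

Lemma cbounded_measurable_tpow_coef (A : 'M[R[i]]_n) j i :
  cbounded_measurable (fun u => tpow_coef (conj_by A u) j i).
Proof.
apply: cbounded_measurable_prod => k; rewrite /conj_by.
under eq_fun do rewrite mxE; apply: cbounded_measurable_sum => l.
apply: cbounded_measurableM; last first.
  under eq_fun do rewrite !mxE; apply: cbounded_measurable_conj.
  exact: cbounded_measurable_entry.
under eq_fun do rewrite mxE; apply: cbounded_measurable_sum => m.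
apply: cbounded_measurableM; first exact: cbounded_measurable_entry.
exact: cbounded_measurable_cst.
Qed.

Variable mu : probability B R.

Lemma bounded_measurable_integrable f : bounded_measurable f ->
  mu.-integrable setT (EFin \o f).
Proof.
move=> [mf [M fM]]; apply: measurable_bounded_integrable => //.
  by rewrite (le_lt_trans (probability_le1 _ _)) ?ltry.
by exists M; split; [exact: num_real | move=> x Mx u _; apply: le_trans (fM u) (ltW Mx)].
Qed.

Lemma cintegralD h k : cbounded_measurable h -> cbounded_measurable k ->
  cintegral mu (fun u => h u + k u) = cintegral mu h + cintegral mu k.
Proof.
move=> [Rh Ih] [Rk Ik]; rewrite /cintegral; apply/eqP; rewrite eq_complex /=.
apply/andP; split; apply/eqP.
  under eq_Rintegral do rewrite raddfD.
  by rewrite RintegralD //; apply: bounded_measurable_integrable.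
under eq_Rintegral do rewrite raddfD.
by rewrite RintegralD //; apply: bounded_measurable_integrable.
Qed.

Lemma cintegralZ a h : cbounded_measurable h ->
  cintegral mu (fun u => a * h u) = a * cintegral mu h.
Proof.
move=> [Rh Ih]; have IR := bounded_measurable_integrable Rh.
have II := bounded_measurable_integrable Ih.
rewrite /cintegral; case: a => a b; apply/eqP; rewrite eq_complex /=.
have bZ (c : R) f : bounded_measurable f -> mu.-integrable setT (EFin \o (fun u => c * f u)).
  move=> bf; apply: bounded_measurable_integrable; apply: bounded_measurableM => //.
  exact: bounded_measurable_cst.
apply/andP; split; apply/eqP.
  under eq_Rintegral do rewrite ReM /=.
  by rewrite RintegralB ?RintegralZl //; apply: bZ.
under eq_Rintegral do rewrite ImM /=.
by rewrite RintegralD ?RintegralZl //; apply: bZ.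
Qed.

Lemma cintegral_cst a : cintegral mu (fun=> a) = a.
Proof.
rewrite /cintegral !Rintegral_cst //.
rewrite [X in fine X](_ : _ = 1%E); last exact: probability_setT.
by rewrite /= !mulr1; case: a.
Qed.

Lemma cintegral_sum (I : Type) (r : seq I) (F : I -> U -> R[i]) :
  (forall i, cbounded_measurable (F i)) ->
  cintegral mu (fun u => \sum_(i <- r) F i u) = \sum_(i <- r) cintegral mu (F i).
Proof.
move=> FP; elim: r => [|i r IH].
  rewrite big_nil -[RHS]cintegral_cst; congr cintegral.
  by apply/funext => u; rewrite big_nil.
rewrite big_cons -IH -cintegralD //; last exact: cbounded_measurable_sum.
by congr cintegral; apply/funext => u; rewrite big_cons.
Qed.

Hypothesis mu_haar : is_haar mu.

(** Change of variables: left invariance says that the pushforward of [mu] by the translation is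
    [mu]. *)
Lemma haar_Rintegral f (g : U) : bounded_measurable f ->
  \int[mu]_u f (unitary_mul g u) = \int[mu]_u f u.
Proof.
move=> bf; have mg := measurable_unitary_mul g; have [mf _] := bf.
rewrite /Rintegral; congr fine.
transitivity (\int[pushforward mu (unitary_mul g : B -> B)]_u (f u)%:E)%E.
  rewrite integral_pushforward ?preimage_setT //.
    exact/measurable_EFinP.
  apply: (@bounded_measurable_integrable (fun u => f (unitary_mul g u))).
  have [_ [M fM]] := bf; split; last by exists M.
  by apply: (measurableT_comp mf mg).
apply: eq_measure_integral => A mA _; exact: mu_haar.
Qed.

Lemma haar_cintegral h (g : U) : cbounded_measurable h ->
  cintegral mu (fun u => h (unitary_mul g u)) = cintegral mu h.
Proof.
move=> [Rh Ih]; rewrite /cintegral.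
by rewrite (haar_Rintegral g Rh) (haar_Rintegral g Ih).
Qed.

End ComplexIntegral.

Lemma lfun_scalar_eigen (F : numClosedFieldType) (V : vectType F) (U : {vspace V})
    (f : 'End(V)) : U != 0%VS -> {in U, forall x, f x \in U} ->
  exists a, exists x, [/\ x \in U, x != 0 & f x = a *: x].
Proof.
move=> U0 fU; have bX := vbasisP U; set X := vbasis U in bX.
have XU (i : 'I_(\dim U)) : X`_i \in U by apply: (basis_mem bX); rewrite mem_nth ?size_tuple.
pose G := \matrix_(i < \dim U, k < \dim U) coord X k (f X`_i).
have [|a] := @eigenvalue_closed F _ G; first by rewrite lt0n dimv_eq0.
case/eigenvalueP => v vG v0; exists a, (\sum_i v 0 i *: X`_i); split.
- by apply: memv_suml => i _; apply: memvZ.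
- apply: contraNneq v0 => E; apply/eqP/rowP => i; rewrite mxE.
  by move/freeP: (basis_free bX); apply.
rewrite linear_sum scaler_sumr.
transitivity (\sum_i (v *m G) 0 i *: X`_i); last first.
  by apply: eq_bigr => i _; rewrite vG mxE scalerA.
under eq_bigr do rewrite linearZ /= (coord_basis bX (fU _ (XU _))) scaler_sumr.
rewrite exchange_big; apply: eq_bigr => k _; rewrite mxE scaler_suml.
by apply: eq_bigr => i _; rewrite mxE scalerA.
Qed.

(** * The averaged operator and Schur's lemma *)

Section AveragedOperator.
Variables (R : realType) (n : nat).
Local Notation U := (unitary_group R n).
Local Notation F := (R[i]).
Local Notation T := (tensor F n).
Variable mu : probability (unitary_borel R n) R.
Hypothesis mu_haar : is_haar mu.
Implicit Types (A : 'M[F]_n) (x : T) (c : multi_index n -> F).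

Lemma pairing_tpow_sum c A x : pairing c (tpow A x) =
  \sum_j \sum_i (c j * x i) * tpow_coef A j i.
Proof.
apply: eq_bigr => j _; rewrite tpowE mulr_sumr; apply: eq_bigr => i _.
by rewrite mulrCA mulrC.
Qed.

Lemma cbounded_measurable_pairing c A x :
  cbounded_measurable (fun u : U => pairing c (tpow (conj_by A u) x)).
Proof.
rewrite (_ : (fun u => _) = fun u : U =>
    \sum_j \sum_i (c j * x i) * tpow_coef (conj_by A u) j i).
  apply: cbounded_measurable_sum => j; apply: cbounded_measurable_sum => i.
  apply: cbounded_measurableM; first exact: cbounded_measurable_cst.
  exact: cbounded_measurable_tpow_coef.
by apply/funext => u; rewrite pairing_tpow_sum.
Qed.

Lemma pairing_averaged_op c A x : pairing c (averaged_op mu A x) =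
  cintegral mu (fun u => pairing c (tpow (conj_by A u) x)).
Proof.
have bm j i : cbounded_measurable (fun u : U => (c j * x i) * tpow_coef (conj_by A u) j i).
  apply: cbounded_measurableM; first exact: cbounded_measurable_cst.
  exact: cbounded_measurable_tpow_coef.
rewrite (_ : (fun u => _) = fun u : U =>
    \sum_j \sum_i (c j * x i) * tpow_coef (conj_by A u) j i); last first.
  by apply/funext => u; rewrite pairing_tpow_sum.
rewrite cintegral_sum => [|j]; last by apply: cbounded_measurable_sum.
apply: eq_bigr => j _; rewrite cintegral_sum //.
rewrite kernel_opE mulr_sumr; apply: eq_bigr => i _.
rewrite cintegralZ; last exact: cbounded_measurable_tpow_coef.
by rewrite mulrCA mulrC.
Qed.

(** A functional vanishing on [N] vanishes on the integrand for every [u], hence on the integral. *)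
Lemma averaged_op_mem (N : {vspace T}) A x :
  (forall g y, y \in N -> tpow g y \in N) -> x \in N -> averaged_op mu A x \in N.
Proof.
move=> NS xN; apply: mem_pairing => c c0; rewrite pairing_averaged_op.
rewrite -[RHS](cintegral_cst mu 0); congr cintegral; apply/funext => u.
by rewrite c0 // NS.
Qed.

Lemma conj_by_mul A (g u : U) :
  conj_by A (unitary_mul g u) = val g *m conj_by A u *m (val g)^t*.
Proof. by rewrite /conj_by /= trmx_mul map_mxM !mulmxA. Qed.

(** Replacing [u] by [g u] under the integral turns the conjugate of [A] times [g] into [g] times
    that conjugate. *)
Lemma averaged_op_tpow A (g : U) x :
  averaged_op mu A (tpow (val g) x) = tpow (val g) (averaged_op mu A x).
Proof.
apply/ffunP => j; rewrite [RHS]lfun_pairing pairing_averaged_op.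
have delta_pairing y : pairing (fun i => (i == j)%:R) y = y j.
  rewrite /pairing (bigD1 j) //= eqxx mul1r big1 ?addr0 // => i /negPf->.
  by rewrite mul0r.
rewrite -[LHS]delta_pairing pairing_averaged_op -(haar_cintegral mu_haar g); last first.
  exact: cbounded_measurable_pairing.
congr cintegral; apply/funext => u; rewrite delta_pairing -lfun_pairing -!tpowM.
congr (tpow _ _ j); rewrite conj_by_mul -!mulmxA.
have /unitarymxP E := valP g.
by rewrite (mulmx1C E) mulmx1 /conj_by !mulmxA.
Qed.

(** The trace passes under the integral, where conjugation invariance makes it constant in [u]. *)
Lemma trace_averaged_op (N : {vspace T}) A :
  (forall g y, y \in N -> tpow g y \in N) ->
  trace_on N (averaged_op mu A) = trace_on N (tpow A).
Proof.
move=> NS; rewrite -[RHS](cintegral_cst mu).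
rewrite (_ : (fun=> _) = fun u : U => \sum_(i < \dim N)
    pairing (fun j => coord (vbasis N) i (tensor_basis F j)) (tpow (conj_by A u) (vbasis N)`_i)).
  rewrite cintegral_sum => [|i]; last exact: cbounded_measurable_pairing.
  by apply: eq_bigr => i _; rewrite coord_pairing pairing_averaged_op.
apply/funext => u; rewrite -(@trace_tpow_conj _ _ _ A (val u) ((val u)^t*)) //.
  by apply: eq_bigr => i _; rewrite coord_pairing.
by apply: mulmx1C; apply/unitarymxP/(valP u).
Qed.

(** Schur's lemma: an eigenspace in [M] is a nonzero submodule, hence all of [M]. *)
Lemma averaged_op_scalar (M : {vspace T}) A : irreducible_submodule M ->
  exists a, {in M, forall x, averaged_op mu A x = a *: x}.
Proof.
case=> MU M0 Mirr; have MS : forall g y, y \in M -> tpow g y \in M.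
  move=> g y; apply: unitary_stable_tpow => u uU z zM.
  by have /subvP := MU (exist _ u uU); apply; apply: memv_img.
have [a [x [xM x0 xE]]] := lfun_scalar_eigen M0 (fun x => averaged_op_mem A (x := x) MS).
exists a; pose N := (M :&: lker (averaged_op mu A - a *: \1%VF))%VS.
have NE y : (y \in N) = (y \in M) && (averaged_op mu A y == a *: y).
  by rewrite memv_cap memv_ker add_lfunE opp_lfunE scale_lfunE id_lfunE subr_eq0.
have [||/eqP|NM] := Mirr N.
- move=> u; apply/subvP => _ /memv_imgP[y + ->]; rewrite !NE => /andP[yM /eqP yE].
  by rewrite MS //= averaged_op_tpow yE linearZ.
- exact: capvSl.
- have : x \in N by rewrite NE xM xE eqxx.
  by move=> + /eqP N0; rewrite N0 memv0 (negPf x0).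
by move=> y; rewrite -{1}NM NE => /andP[_ /eqP].
Qed.

End AveragedOperator.

(** * The trace formula *)

(** The image is a submodule. It lies in [M] because the image of [row_sym] is spanned by the
    [tpow g e_row], which [gamma] sends to [tpow g w]; it is nonzero because it contains [w]. *)
Lemma irreducible_limg_hwv_op (R : realType) (eta : seq nat) (eta_pos : 0%N \notin eta)
    (M : {vspace tensor R[i] (sumn eta)}) w :
  irreducible_submodule M -> w \in M -> w != 0 -> highest_weight_vector w ->
  limg (hwv_op eta_pos w) = M.
Proof.
case=> MU M0 Mirr wM w0 hw.
have MS g y : y \in M -> tpow g y \in M.
  apply: unitary_stable_tpow => u uU z zM.
  by have /subvP := MU (exist _ u uU); apply; apply: memv_img.
have [||/eqP|//] := Mirr (limg (hwv_op eta_pos w)).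
- move=> u; apply/subvP => _ /memv_imgP[_ /memv_imgP[x _ ->] ->].
  by rewrite -hwv_op_tpow memv_img ?memvf.
- apply/subvP => _ /memv_imgP[x _ ->]; rewrite comp_lfunE memv_preim.
  apply: (row_sym_mem (eta_pos := eta_pos)) => g; rewrite -memv_preim.
  by rewrite group_op_tpow group_op_hwv_coef // MS.
suff : w \in limg (hwv_op eta_pos w).
  by move=> + /eqP L0; rewrite L0 memv0 (negPf w0).
have wE : hwv_op eta_pos w ((#|row_stab (sumn eta) eta|%:R)^-1 *:
    tensor_basis R[i] (row_filling eta_pos)) = w.
  rewrite comp_lfunE linearZ /= row_sym_row_filling scalerA mulVf ?card_row_stab_neq0 //.
  by rewrite scale1r group_op_hwv_coef.
by rewrite -[X in X \in _]wE memv_img ?memvf.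
Qed.

Unset Implicit Arguments.
Local Close Scope sesquilinear_scope.

Theorem mainTheorem3 (R : realType) (n : nat) (n_ge1 : (1 <= n)%N)
    (mu : probability (unitary_borel R n) R) (mu_haar : is_haar mu)
    (eta : seq nat) (eta_part : is_partition eta n)
    (M : {vspace tensor R[i] n}) (M_irr : irreducible_submodule M)
    (M_eta : has_highest_weight M eta) (A : 'M[R[i]]_n) :
  trace_on (M :&: zero_weight_space R[i] n)%VS (averaged_op mu A) =
    schur_mx eta A / schur_mx eta (1%:M : 'M[R[i]]_n)
      * sym_char R[i] eta (1%g : 'S_n).
Proof.
case/and3P: eta_part => eta_sorted eta_pos /eqP n_eq; subst n.
have [w [wM w0 hw]] := M_eta.
have LM := irreducible_limg_hwv_op eta_pos M_irr wM w0 hw.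
have MS g y : y \in M -> tpow g y \in M.
  by rewrite -LM => /memv_imgP[x _ ->]; rewrite -hwv_op_tpow memv_img ?memvf.
have chM B : trace_on M (tpow B) = schur_mx eta B.
  rewrite -LM (trace_hwv_op eta_sorted) ?trace_young_op // => c x.
  by rewrite group_op_tpow.
(* The denominator is the trace of the identity on [M]. *)
have dimM : schur_mx eta (1%:M : 'M[R[i]]_(sumn eta)) = (\dim M)%:R.
  rewrite -chM (@trace_on_scalar _ _ _ _ 1) ?mul1r // => x _.
  by rewrite tpow1 scale1r.
have dimM0 : (\dim M)%:R != 0 :> R[i].
  by rewrite pnatr_eq0 dimv_eq0; case: M_irr.
have [a aE] := averaged_op_scalar mu_haar A M_irr.
have -> : schur_mx eta A = a * (\dim M)%:R.
  rewrite -chM -(trace_averaged_op mu A MS); exact: trace_on_scalar.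
rewrite dimM mulfK // (@trace_on_scalar _ _ _ _ a) => [|x]; last first.
  by rewrite memv_cap => /andP[xM _]; apply: aE.
(* The scalar [a] is split off; what remains is that [M(0)] has the degree of the Specht
   representation as its dimension. *)
congr (_ * _); rewrite /sym_char repr_mx1 mxtrace1 -LM.
by rewrite (dim_hwv_zero_weight eta_sorted).
Qed.
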